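(* Fix $\mathbf{s}\in\mathcal{S}(m|n)$. The set of all ordered monomials $$\overrightarrow{\prod_{1\le i\le N}} t_{i,i-1,\mathbf{s}}^{b_{i,i-1}}t_{i,i-2,\mathbf{s}}^{b_{i,i-2}}\cdots t_{i,1,\mathbf{s}}^{b_{i,1}}\ \times\ \overrightarrow{\prod_{1\le i\le N}}\bar t_{ii,\mathbf{s}}^{\,b_{ii}}\ \times\ \overrightarrow{\prod_{1\le i\le N}}\bar t_{1,i,\mathbf{s}}^{\,b_{1,i}}\bar t_{2,i,\mathbf{s}}^{\,b_{2,i}}\cdots\bar t_{i-1,i,\mathbf{s}}^{\,b_{i-1,i}}$$ (each product taken in increasing order of $i$), with exponents $b_{ij}\in\mathbb{Z}_{\ge0}$ if $i\ne j$ and $|i|+|j|=\bar0$, $b_{ij}\in\{0,1\}$ if $|i|+|j|=\bar1$, and $b_{ii}\in\mathbb{Z}$, forms a basis of $\mathrm{U}_q(\mathfrak{g}_{\mathbf{s}})$ over $\mathbb{C}$.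
   Context: Everything is over $\mathbb{C}$; $q\in\mathbb{C}\setminus\{0\}$ is not a root of unity; $m,n\in\mathbb{Z}_{\ge0}$, $N=m+n\ge2$. $\mathcal{S}(m|n)$ is the set of sequences $\mathbf{s}=s_1\cdots s_N$ with exactly $m$ zeros and $n$ ones. Given $\mathbf{s}$: $|i|=\bar0$, $d_i=1$ if $s_i=0$, and $|i|=\bar1$, $d_i=-1$ if $s_i=1$; $q_i=q^{d_i}$; $\varsigma_{ab;cd}=(-1)^{(|a|+|b|)(|c|+|d|)}$; $\delta_{\mathrm{cond}}$ is $1$ if the condition holds and $0$ otherwise. $\mathrm{U}_q(\mathfrak{g}_{\mathbf{s}})$ (the RTT presentation of the quantum general linear superalgebra) is the associative superalgebra generated by $t_{ji}=t_{ji,\mathbf{s}}$ and $\bar t_{ij}=\bar t_{ij,\mathbf{s}}$, $1\le i\le j\le N$, both of parity $|i|+|j|$ (with the convention $t_{ij}=0=\bar t_{ji}$ for $i<j$), with relations $t_{ii}\bar t_{ii}=\bar t_{ii}t_{ii}=1$ and, for all $i,j,k,l$, $$q_i^{\delta_{ik}}t_{ij}t_{kl}-\varsigma_{ij;kl}q_j^{\delta_{jl}}t_{kl}t_{ij}=\varsigma_{ik;kl}(q_k-q_k^{-1})(\delta_{j<l}-\delta_{k<i})t_{kj}t_{il},$$ the same relation with every $t$ replaced by $\bar t$, and $$q_i^{\delta_{ik}}t_{ij}\bar t_{kl}-\varsigma_{ij;kl}q_j^{\delta_{jl}}\bar t_{kl}t_{ij}=\varsigma_{ik;kl}(q_k-q_k^{-1})(\delta_{j<l}\bar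 t_{kj}t_{il}-\delta_{k<i}t_{kj}\bar t_{il}).$$ *)

(* Defs.v *)
From HB Require Import structures.
From mathcomp Require Import all_boot all_order all_algebra.
From mathcomp Require Import generic_quotient ring_quotient.
From mathcomp Require Import boolp.
From mathcomp Require Export reals complex.
From mathcomp Require Import finmap monalg.

Set Implicit Arguments.
Unset Strict Implicit.
Unset Printing Implicit Defensive.

Import Order.TTheory GRing.Theory Num.Theory.

Local Open Scope ring_scope.

Definition is_basis (K : fieldType) (V : lmodType K) (I : choiceType)
    (e : I -> V) : Prop :=
  (forall (r : seq I) (c : I -> K), uniq r ->
     \sum_(i <- r) c i *: e i = 0 -> forall i, i \in r -> c i = 0) /\
  (forall v : V, exists (r : seq I) (c : I -> K), v = \sum_(i <- r) c i *: e i).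

(* Entries false and true stand for the letters 0 and 1. *)
Definition is_parity_seq (m n : nat) (s : (m + n).-tuple bool) : bool :=
  (count_mem false s == m) && (count_mem true s == n).

(* Two-sided ideal generated by the elements x - y with rel x y. *)
Inductive two_sided_ideal (R : nzRingType) (rel : R -> R -> Prop) : R -> Prop :=
| ideal_rel x y : rel x y -> two_sided_ideal rel (x - y)
| ideal_0 : two_sided_ideal rel 0
| ideal_D x y : two_sided_ideal rel x -> two_sided_ideal rel y ->
    two_sided_ideal rel (x + y)
| ideal_Ml a x : two_sided_ideal rel x -> two_sided_ideal rel (a * x)
| ideal_Mr a x : two_sided_ideal rel x -> two_sided_ideal rel (x * a).

Section NoncommutativePolynomials.
Variables (K : fieldType) (I : choiceType).

Definition ncpoly : Type := {malg K[{fmonom I}]}.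
HB.instance Definition _ := GRing.Lalgebra.on ncpoly.

Fact ncpoly_scalerAr (c : K) (x y : ncpoly) : c *: (x * y) = x * (c *: y).
Proof.
have cC : c%:MP * x = x * c%:MP :> ncpoly.
  rewrite mul_malgC malgM_def fgmulgU {1}[x]monalgE scaler_sumr.
  apply: eq_bigr => k _; apply/malgP => w.
  by rewrite mcoeffZ !mcoeffU mulm1 mulrnAr mulrC.
by rewrite -!mul_malgC mulrA cC mulrA.
Qed.
HB.instance Definition _ := GRing.Lalgebra_isAlgebra.Build K ncpoly ncpoly_scalerAr.

Section Evaluation.
Variables (B : algType K) (h : I -> B).

Definition word_eval (w : {fmonom I}) : B := \prod_(g <- (w : seq I)) h g.

Fact word_eval_mult : mmorphism word_eval.
Proof. by split=> [x y|]; rewrite /word_eval ?fmM ?big_cat // fm1 big_nil. Qed.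
HB.instance Definition _ := isMultiplicative.Build _ _ word_eval word_eval_mult.

Definition ncpoly_eval (x : ncpoly) : B := mmap (in_alg B) word_eval x.

Fact ncpoly_eval_zmod : zmod_morphism ncpoly_eval.
Proof. exact: mmapB. Qed.

Fact ncpoly_eval_monoid : monoid_morphism ncpoly_eval.
Proof.
have cf (g : {malg K[{fmonom I}]}) (w w' : {fmonom I}) :
    GRing.comm (in_alg B g@_w) (word_eval w').
  by rewrite /GRing.comm /= -scalerAl -scalerAr mul1r mulr1.
by case: (commr_mmap_is_multiplicative (f := in_alg B) cf).
Qed.

Fact ncpoly_eval_scalable : scalable ncpoly_eval.
Proof.
move=> c x; apply: etrans; first exact: (mmapZ (f := in_alg B)).
by rewrite /= -scalerAl mul1r.
Qed.

HB.instance Definition _ :=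
  GRing.isZmodMorphism.Build ncpoly B ncpoly_eval ncpoly_eval_zmod.
HB.instance Definition _ :=
  GRing.isMonoidMorphism.Build ncpoly B ncpoly_eval ncpoly_eval_monoid.
HB.instance Definition _ :=
  GRing.isScalable.Build K ncpoly B *:%R ncpoly_eval ncpoly_eval_scalable.

Fact ncpoly_eval_var g : ncpoly_eval << fmu g >> = h g.
Proof.
by rewrite /ncpoly_eval mmapU /= scale1r mul1r /word_eval fmU big_seq1.
Qed.

End Evaluation.
End NoncommutativePolynomials.

(* The free associative algebra on I together with its generators; it is locked
   because unification is very slow through the instances of [malg]. *)
HB.lock Definition free_algebra (K : fieldType) (I : choiceType) :
    {A : algType K & I -> A} :=
  existT (fun A : algType K => I -> A) (ncpoly K I : algType K)
    (fun g => << fmu g >>).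

Definition free_alg (K : fieldType) (I : choiceType) : algType K :=
  projT1 (free_algebra K I).

Definition free_var (K : fieldType) (I : choiceType) : I -> free_alg K I :=
  projT2 (free_algebra K I).

Lemma free_alg_eval (K : fieldType) (I : choiceType) (B : algType K) (h : I -> B) :
  exists f : {lrmorphism free_alg K I -> B}, forall g, f (free_var K g) = h g.
Proof.
rewrite /free_alg /free_var free_algebra.unlock /=.
by exists (ncpoly_eval h); exact: ncpoly_eval_var.
Qed.

Section RTT.
Variables (K : fieldType) (N : nat) (s : N.-tuple bool) (q : K).

Definition parity (i : 'I_N) : bool := tnth s i.

Definition d (i : 'I_N) : int := if parity i then -1 else 1.

Definition q_ (i : 'I_N) : K := q ^ d i.

Definition varsigma (a b c e : 'I_N) : K :=
  (-1) ^+ ((parity a (+) parity b) && (parity c (+) parity e)).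

Inductive rtt_rel (A : algType K) (t tbar : 'I_N -> 'I_N -> A) : A -> A -> Prop :=
| rtt_inv_r i : rtt_rel t tbar (t i i * tbar i i) 1
| rtt_inv_l i : rtt_rel t tbar (tbar i i * t i i) 1
| rtt_tt i j k l : rtt_rel t tbar
    (q_ i ^+ (i == k) *: (t i j * t k l)
       - (varsigma i j k l * q_ j ^+ (j == l)) *: (t k l * t i j))
    ((varsigma i k k l * (q_ k - (q_ k)^-1) * ((j < l)%N%:R - (k < i)%N%:R))
       *: (t k j * t i l))
| rtt_bb i j k l : rtt_rel t tbar
    (q_ i ^+ (i == k) *: (tbar i j * tbar k l)
       - (varsigma i j k l * q_ j ^+ (j == l)) *: (tbar k l * tbar i j))
    ((varsigma i k k l * (q_ k - (q_ k)^-1) * ((j < l)%N%:R - (k < i)%N%:R))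
       *: (tbar k j * tbar i l))
| rtt_tb i j k l : rtt_rel t tbar
    (q_ i ^+ (i == k) *: (t i j * tbar k l)
       - (varsigma i j k l * q_ j ^+ (j == l)) *: (tbar k l * t i j))
    ((varsigma i k k l * (q_ k - (q_ k)^-1))
       *: ((j < l)%N%:R *: (tbar k j * t i l)
             - (k < i)%N%:R *: (t k j * tbar i l))).

(* [inl (j, i)] is t_{ji} and [inr (i, j)] is \bar t_{ij}, for i <= j. *)
Definition gen : Type :=
  ({p : 'I_N * 'I_N | (p.2 <= p.1)%N} + {p : 'I_N * 'I_N | (p.1 <= p.2)%N})%type.
HB.instance Definition _ := Finite.on gen.

Local Notation free := (free_alg K gen).

Definition free_t (i j : 'I_N) : free :=
  oapp (fun u => free_var K (inl u : gen)) 0 (insub (i, j)).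

Definition free_tbar (i j : 'I_N) : free :=
  oapp (fun u => free_var K (inr u : gen)) 0 (insub (i, j)).

Definition rtt_ideal : {pred free} :=
  fun x => `[< two_sided_ideal (rtt_rel free_t free_tbar) x >].

Lemma rtt_idealP x :
  reflect (two_sided_ideal (rtt_rel free_t free_tbar) x) (x \in rtt_ideal).
Proof. exact: asboolP. Qed.

Fact rtt_ideal_zmod_closed : zmod_closed rtt_ideal.
Proof.
split=> [|x y /rtt_idealP hx /rtt_idealP hy]; apply/rtt_idealP.
  exact: ideal_0.
by rewrite -(mulN1r y); apply: ideal_D => //; apply: ideal_Ml.
Qed.
HB.instance Definition _ :=
  GRing.isZmodClosed.Build free rtt_ideal rtt_ideal_zmod_closed.

(* The quotient algebra U_q(g_s). The relations are homogeneous for the parity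
   |i| + |j| of t_ij and \bar t_ij, which makes Uq a superalgebra: see
   [Uq_parity] below. *)
Definition Uq : Type := Quotient.quot rtt_ideal.
HB.instance Definition _ := GRing.Zmodule.on Uq.
HB.instance Definition _ := EqQuotient.on Uq.

Local Notation pi := (\pi_Uq)%qT.

Lemma rtt_rel_morph (A B : algType K) (f : {lrmorphism A -> B})
    (t tbar : 'I_N -> 'I_N -> A) x y :
  rtt_rel t tbar x y ->
  rtt_rel (fun i j => f (t i j)) (fun i j => f (tbar i j)) (f x) (f y).
Proof.
have fZ c z : f (c *: z) = c *: f z by exact: linearZ.
have fB z z' : f (z - z') = f z - f z' by exact: rmorphB.
have fM z z' : f (z * z') = f z * f z' by exact: rmorphM.
case=> [i|i|i j k l|i j k l|i j k l].
- by rewrite fM rmorph1; exact: (rtt_inv_r (fun i j => f (t i j))).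
- by rewrite fM rmorph1; exact: (rtt_inv_l (fun i j => f (t i j))).
- by rewrite fB !fZ !fM; exact: (rtt_tt (fun i j => f (t i j))).
- by rewrite fB !fZ !fM; exact: (rtt_bb (fun i j => f (t i j))).
rewrite fB !fZ fB !fZ !fM.
exact: (rtt_tb (fun i j => f (t i j))).
Qed.

Lemma free_eval (A : algType K) (t tbar : 'I_N -> 'I_N -> A) :
  (forall i j : 'I_N, (i < j)%N -> t i j = 0 /\ tbar j i = 0) ->
  exists f : {lrmorphism free -> A},
    forall i j, f (free_t i j) = t i j /\ f (free_tbar i j) = tbar i j.
Proof.
move=> h0.
pose h (g : gen) := match g with
  | inl u => t (val u).1 (val u).2
  | inr u => tbar (val u).1 (val u).2 end.
have [f fE] := free_alg_eval h; exists f => i j; split.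
  rewrite /free_t; case: insubP => [u _ uE|] /=; first by rewrite fE /= uE.
  by rewrite -ltnNge raddf0 => /h0[-> _].
rewrite /free_tbar; case: insubP => [u _ uE|] /=; first by rewrite fE /= uE.
by rewrite -ltnNge raddf0 => /h0[_ ->].
Qed.

Lemma rtt_ideal_eval (A : algType K) (t tbar : 'I_N -> 'I_N -> A)
    (f : {lrmorphism free -> A}) :
  (forall i j, f (free_t i j) = t i j /\ f (free_tbar i j) = tbar i j) ->
  (forall x y, rtt_rel t tbar x y -> x = y) ->
  forall x, two_sided_ideal (rtt_rel free_t free_tbar) x -> f x = 0.
Proof.
move=> fE rel0 x.
have fD z z' : f (z + z') = f z + f z' by exact: rmorphD.
have fM z z' : f (z * z') = f z * f z' by exact: rmorphM.
elim=> {x} [x y xy||x y _ hx _ hy|a x _ hx|a x _ hx].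
- rewrite rmorphB; apply/eqP; rewrite subr_eq0; apply/eqP; apply: rel0.
  have -> : t = (fun i j => f (free_t i j)).
    by apply/funext => i; apply/funext => j; case: (fE i j).
  have -> : tbar = (fun i j => f (free_tbar i j)).
    by apply/funext => i; apply/funext => j; case: (fE i j).
  exact: rtt_rel_morph.
- exact: rmorph0.
- by rewrite fD hx hy addr0.
- by rewrite fM hx mulr0.
- by rewrite fM hx mul0r.
Qed.

(* t_ij, \bar t_ij |-> delta_ij satisfies the relations, so Uq is nonzero. *)
Lemma rtt_rel_delta (A : algType K) (x y : A) :
  rtt_rel (fun i j => (i == j)%:R) (fun i j => (i == j)%:R) x y -> x = y.
Proof.
have E i j k l (c : K) :
    q_ i ^+ (i == k) *: ((i == j)%:R * (k == l)%:R : A)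
      - (varsigma i j k l * q_ j ^+ (j == l)) *: ((k == l)%:R * (i == j)%:R)
  = (c * ((j < l)%N%:R - (k < i)%N%:R)) *: ((k == j)%:R * (i == l)%:R).
  have -> : (c * ((j < l)%N%:R - (k < i)%N%:R)) *: ((k == j)%:R * (i == l)%:R : A) = 0.
    case: (k =P j) => [->|_]; last by rewrite mul0r scaler0.
    by case: (i =P l) => [->|_]; rewrite ?subrr ?mulr0 ?scale0r ?scaler0.
  case: (i =P j) => [->|_]; last by rewrite mul0r mulr0 !scaler0 subr0.
  case: (k =P l) => [->|_]; last by rewrite mul0r mulr0 !scaler0 subr0.
  by rewrite /varsigma addbb expr0 !mul1r subrr.
case=> [i|i|i j k l|i j k l|i j k l].
- by rewrite eqxx mulr1.
- by rewrite eqxx mulr1.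
- exact: E.
- exact: E.
- by rewrite -scalerBl scalerA; apply: E.
Qed.

Lemma rtt_ideal_proper : ~ two_sided_ideal (rtt_rel free_t free_tbar) 1.
Proof.
have [|f fE] := @free_eval K^o (fun i j => (i == j)%:R) (fun i j => (i == j)%:R).
  by move=> i j ij; rewrite -!val_eqE /= (gtn_eqF ij) (ltn_eqF ij).
move/(rtt_ideal_eval fE (@rtt_rel_delta _))/eqP.
by rewrite rmorph1 oner_eq0.
Qed.

Definition Uq_one : Uq := lift_cst Uq 1.
Definition Uq_mul := lift_op2 Uq ( *%R : free -> free -> free).
Definition Uq_scale (c : K) := lift_op1 Uq ( *:%R c : free -> free).

Lemma Uq_eqP x y :
  pi x = pi y <-> two_sided_ideal (rtt_rel free_t free_tbar) (x - y).
Proof.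
split=> [/eqP|/rtt_idealP] h; [apply/rtt_idealP|apply/eqP];
  by rewrite ?Quotient.idealrBE // -Quotient.idealrBE.
Qed.

Lemma repr_pi x :
  two_sided_ideal (rtt_rel free_t free_tbar) (repr (pi x) - x).
Proof. by apply/Uq_eqP; rewrite reprK. Qed.

Lemma Uq_pi1 : pi 1 = Uq_one.
Proof. by unlock Uq_one. Qed.

Lemma Uq_piD x y : pi (x + y) = pi x + pi y.
Proof. exact: Quotient.pi_add. Qed.

Lemma Uq_piM x y : pi (x * y) = Uq_mul (pi x) (pi y).
Proof.
unlock Uq_mul; apply/esym/Uq_eqP.
set x' := repr _; set y' := repr _.
have -> : x' * y' - x * y = (x' - x) * y' + x * (y' - y).
  by rewrite mulrBl mulrBr addrA subrK.
by apply: ideal_D; [apply: ideal_Mr|apply: ideal_Ml]; apply: repr_pi.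
Qed.

Lemma Uq_piZ c x : pi (c *: x) = Uq_scale c (pi x).
Proof.
unlock Uq_scale; apply/esym/Uq_eqP; rewrite -scalerBr -[_ - _]mul1r scalerAl.
by apply: ideal_Ml; apply: repr_pi.
Qed.

Fact Uq_mulA : associative Uq_mul.
Proof.
move=> x y z; rewrite -[x]reprK -[y]reprK -[z]reprK.
by rewrite -!Uq_piM mulrA.
Qed.

Fact Uq_mul1 : left_id Uq_one Uq_mul.
Proof. by move=> x; rewrite -[x]reprK -Uq_pi1 -Uq_piM mul1r. Qed.

Fact Uq_mulr1 : right_id Uq_one Uq_mul.
Proof. by move=> x; rewrite -[x]reprK -Uq_pi1 -Uq_piM mulr1. Qed.

Fact Uq_mulDl : left_distributive Uq_mul +%R.
Proof.
move=> x y z; rewrite -[x]reprK -[y]reprK -[z]reprK.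
by rewrite -Uq_piD -!Uq_piM -Uq_piD mulrDl.
Qed.

Fact Uq_mulDr : right_distributive Uq_mul +%R.
Proof.
move=> x y z; rewrite -[x]reprK -[y]reprK -[z]reprK.
by rewrite -Uq_piD -!Uq_piM -Uq_piD mulrDr.
Qed.

Fact Uq_one_neq0 : Uq_one != 0.
Proof.
apply/eqP; have -> : 0 = pi 0 :> Uq by rewrite piE.
by rewrite -Uq_pi1 => /Uq_eqP; rewrite subr0; apply: rtt_ideal_proper.
Qed.

HB.instance Definition _ := GRing.Zmodule_isNzRing.Build Uq
  Uq_mulA Uq_mul1 Uq_mulr1 Uq_mulDl Uq_mulDr Uq_one_neq0.

Fact Uq_scalerA a b x : Uq_scale a (Uq_scale b x) = Uq_scale (a * b) x.
Proof. by rewrite -[x]reprK -!Uq_piZ scalerA. Qed.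

Fact Uq_scale1 : left_id 1 Uq_scale.
Proof. by move=> x; rewrite -[x]reprK -Uq_piZ scale1r. Qed.

Fact Uq_scalerDr : right_distributive Uq_scale +%R.
Proof.
by move=> a x y; rewrite -[x]reprK -[y]reprK -Uq_piD -!Uq_piZ -Uq_piD scalerDr.
Qed.

Fact Uq_scalerDl x : {morph Uq_scale^~ x : a b / a + b}.
Proof. by move=> a b; rewrite -[x]reprK -!Uq_piZ -Uq_piD scalerDl. Qed.

HB.instance Definition _ := GRing.Zmodule_isLmodule.Build K Uq
  Uq_scalerA Uq_scale1 Uq_scalerDr Uq_scalerDl.

Fact Uq_scalerAl a (x y : Uq) : a *: (x * y) = a *: x * y.
Proof.
rewrite -[x]reprK -[y]reprK.
by rewrite -[LHS]/(Uq_scale _ (Uq_mul _ _)) -[RHS]/(Uq_mul (Uq_scale _ _) _)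
           -!Uq_piZ -!Uq_piM -Uq_piZ scalerAl.
Qed.
HB.instance Definition _ := GRing.Lmodule_isLalgebra.Build K Uq Uq_scalerAl.

Fact Uq_scalerAr a (x y : Uq) : a *: (x * y) = x * (a *: y).
Proof.
rewrite -[x]reprK -[y]reprK.
by rewrite -[LHS]/(Uq_scale _ (Uq_mul _ _)) -[RHS]/(Uq_mul _ (Uq_scale _ _))
           -!Uq_piZ -!Uq_piM -Uq_piZ scalerAr.
Qed.
HB.instance Definition _ := GRing.Lalgebra_isAlgebra.Build K Uq Uq_scalerAr.

Fact Uq_pi_zmod : zmod_morphism (\pi_Uq : free -> Uq)%qT.
Proof. by move=> x y /=; rewrite !piE. Qed.
Fact Uq_pi_monoid : monoid_morphism (\pi_Uq : free -> Uq)%qT.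
Proof. by split; [exact: Uq_pi1|exact: Uq_piM]. Qed.
Fact Uq_pi_scalable : scalable (\pi_Uq : free -> Uq)%qT.
Proof. exact: Uq_piZ. Qed.

Definition Uq_pi (x : free) : Uq := pi x.
HB.instance Definition _ := GRing.isZmodMorphism.Build free Uq Uq_pi Uq_pi_zmod.
HB.instance Definition _ := GRing.isMonoidMorphism.Build free Uq Uq_pi Uq_pi_monoid.
HB.instance Definition _ := GRing.isScalable.Build K free Uq *:%R Uq_pi Uq_pi_scalable.

Definition t (i j : 'I_N) : Uq := Uq_pi (free_t i j).
Definition tbar (i j : 'I_N) : Uq := Uq_pi (free_tbar i j).

Lemma t_eq0 (i j : 'I_N) : (i < j)%N -> t i j = 0 /\ tbar j i = 0.
Proof.
move=> ij; rewrite /t /tbar /free_t /free_tbar.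
by rewrite !insubF ?raddf0 //=; apply/negbTE; rewrite -ltnNge.
Qed.

Lemma Uq_rel x y : rtt_rel t tbar x y -> x = y.
Proof.
have fZ c z : Uq_pi (c *: z) = c *: Uq_pi z by exact: linearZ.
have fB z z' : Uq_pi (z - z') = Uq_pi z - Uq_pi z' by exact: rmorphB.
have fM z z' : Uq_pi (z * z') = Uq_pi z * Uq_pi z' by exact: rmorphM.
have f1 : Uq_pi 1 = 1 by exact: rmorph1.
have rel0 z z' : rtt_rel free_t free_tbar z z' -> Uq_pi z = Uq_pi z'.
  by move=> zz'; apply/Uq_eqP/ideal_rel.
case=> [i|i|i j k l|i j k l|i j k l].
- by have := rel0 _ _ (rtt_inv_r _ _ i); rewrite fM f1.
- by have := rel0 _ _ (rtt_inv_l _ _ i); rewrite fM f1.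
- by have := rel0 _ _ (rtt_tt _ _ i j k l); rewrite fB !fZ !fM.
- by have := rel0 _ _ (rtt_bb _ _ i j k l); rewrite fB !fZ !fM.
by have := rel0 _ _ (rtt_tb _ _ i j k l); rewrite fB !fZ fB !fZ !fM.
Qed.

(* Uq has the universal property of the presentation. *)
Lemma Uq_eval (A : algType K) (T Tbar : 'I_N -> 'I_N -> A) :
  (forall i j : 'I_N, (i < j)%N -> T i j = 0 /\ Tbar j i = 0) ->
  (forall x y, rtt_rel T Tbar x y -> x = y) ->
  exists f : {lrmorphism Uq -> A},
    forall i j, f (t i j) = T i j /\ f (tbar i j) = Tbar i j.
Proof.
move=> h0 hrel; have [f fE] := free_eval h0.
pose F (u : Uq) : A := f (repr u).
have FE x : F (Uq_pi x) = f x.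
  apply/eqP; rewrite -subr_eq0 -raddfB; apply/eqP.
  exact: (rtt_ideal_eval fE hrel (repr_pi x)).
have piK (u : Uq) : u = Uq_pi (repr u) by rewrite /Uq_pi reprK.
have Fz : zmod_morphism F.
  by move=> u v; rewrite (piK u) (piK v) -raddfB !FE raddfB.
have Fm : monoid_morphism F.
  split=> [|u v]; first by rewrite -(rmorph1 Uq_pi) FE rmorph1.
  by rewrite (piK u) (piK v) -rmorphM !FE rmorphM.
have Fs : scalable F.
  by move=> c u; rewrite (piK u) -linearZ !FE linearZ.
pose zm := GRing.isZmodMorphism.Build Uq A F Fz.
pose mm := GRing.isMonoidMorphism.Build Uq A F Fm.
pose sm := GRing.isScalable.Build K Uq A *:%R F Fs.
pose G : {lrmorphism Uq -> A} := HB.pack F zm mm sm.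
by exists G => i j; rewrite /G /= /t /tbar !FE.
Qed.

(* The automorphism whose (-1)^p-eigenspace is the component of parity p. *)
Lemma Uq_parity : exists f : {lrmorphism Uq -> Uq}, forall i j,
  f (t i j) = (-1) ^+ (parity i (+) parity j) *: t i j /\
  f (tbar i j) = (-1) ^+ (parity i (+) parity j) *: tbar i j.
Proof.
pose sg i j : K := (-1) ^+ (parity i (+) parity j).
have sg2 i j k l : sg i j * sg k l = sg k j * sg i l.
  by rewrite /sg -!signr_addb addbACA [parity i (+) _]addbC addbACA.
have sgD i j k l (u v : Uq) :
    (sg i j *: u) * (sg k l *: v) = (sg i j * sg k l) *: (u * v).
  by rewrite -scalerAl -scalerAr scalerA.
have sgC i j k l : sg k l * sg i j = sg i j * sg k l by rewrite mulrC.
have twist (a b c e : K) (u v w : Uq) : a *: u - b *: v = c *: w ->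
    a *: (e *: u) - b *: (e *: v) = c *: (e *: w).
  move=> uvw; rewrite ![_ *: (e *: _)]scalerA ![_ * e]mulrC -!scalerA.
  by rewrite -scalerBr uvw.
apply: (Uq_eval (T := fun i j => sg i j *: t i j)
                (Tbar := fun i j => sg i j *: tbar i j)).
  by move=> i j /t_eq0[-> ->]; rewrite !scaler0.
move=> x y; case=> [i|i|i j k l|i j k l|i j k l].
- by rewrite /sg addbb !scale1r; apply/Uq_rel/rtt_inv_r.
- by rewrite /sg addbb !scale1r; apply/Uq_rel/rtt_inv_l.
- by rewrite !sgD (sgC i j k l) -(sg2 i j k l); apply/twist/Uq_rel/rtt_tt.
- by rewrite !sgD (sgC i j k l) -(sg2 i j k l); apply/twist/Uq_rel/rtt_bb.
rewrite !sgD (sgC i j k l) -(sg2 i j k l).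
set u := tbar k j * _; set v := t k j * _; set e := sg i j * _.
have -> : (j < l)%N%:R *: (e *: u) - (k < i)%N%:R *: (e *: v)
       = e *: ((j < l)%N%:R *: u - (k < i)%N%:R *: v).
  by rewrite scalerBr !scalerA ![e * _]mulrC.
by apply/twist/Uq_rel/rtt_tb.
Qed.

(* \bar t_ii^b, where \bar t_ii has inverse t_ii and [Negz k] is -(k + 1). *)
Definition tbar_diag_exp (i : 'I_N) (b : int) : Uq :=
  match b with
  | Posz k => tbar i i ^+ k
  | Negz k => t i i ^+ k.+1
  end.

Definition pbw_exponents (b : 'M[int]_N) : bool :=
  [forall i, forall j, (i != j) ==>
     (0 <= b i j) && (parity i (+) parity j ==> (b i j <= 1))].

(* The factors t_{i,j} run over j = i-1, ..., 1 and \bar t_{j,i} over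
   j = 1, ..., i-1. *)
Definition pbw_monomial (b : 'M[int]_N) : Uq :=
  (\prod_(i < N) \prod_(j <- rev (enum 'I_N) | (j < i)%N) t i j ^+ `|b i j|%N)
  * (\prod_(i < N) tbar_diag_exp i (b i i))
  * (\prod_(i < N) \prod_(j < N | (j < i)%N) tbar j i ^+ `|b j i|%N).

End RTT.

(* Main.v *)
(* Spanning: the mixed relations move every \bar t to the right of every t, and
   for k < i a product t_ij t_kl is a combination of t_kl t_ij and t_kj t_il, so
   words in the t's can be sorted by rows (those in the \bar t's by columns); inside
   a row the letters commute up to scalars and odd letters square to zero.

   Independence: composing the coproduct with the vector representation, or with
   its dual, in one tensor factor gives homomorphisms from Uq to matrices over Uq
   which keep the column, respectively row, indices of the generators. Such a
   homomorphism only requires the Yang-Baxter equation. If in a linear relation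
   rows below r do not occur and t_rj does not occur for j < c, then taking the
   matrix entry (r, c) turns each ordered monomial containing t_rc into a nonzero
   multiple of the monomial with one factor t_rc replaced by t_rr, and kills the
   others: the only path from r to c goes through one letter t_rc, and the sum over
   the choices of that letter is a q-integer. Hence the exponents of the t's, and in
   the same way those of the \bar t's, can be removed one at a time until only
   diagonal monomials are left; these are eigenvectors, for the diagonal matrix
   entries, with distinct systems of eigenvalues. *)
Require Import Defs.
From HB Require Import structures.
From mathcomp Require Import all_boot all_order all_algebra reals complex.
From mathcomp Require Import boolp ring zify.
From mathcomp Require Import finmap monalg.

Set Implicit Arguments.
Unset Strict Implicit.
Unset Printing Implicit Defensive.

Import Order.TTheory GRing.Theory Num.Theory.

Local Open Scope ring_scope.

(** * The Yang-Baxter equation for the vector representation and its dual *)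

(** No coproduct on [Uq] is formed. Matrices over [Uq] itself stand for the super tensor product
    with End(V), and the universal property [Uq_eval] reduces the existence of each homomorphism to
    an identity between scalars. Signs are the first obstacle. After twisting by the parity operator
    the super R-matrix becomes an ordinary one whose diagonal entries are q for even and -1/q for
    odd indices, the two roots of x^2 - (q - 1/q) x - 1; parity then enters the Yang-Baxter equation
    only through this quadratic relation and through signs off the diagonal. Two representations are
    used because each sees one half of the generators. In the vector representation the t's act by
    upper and the \bar t's by lower triangular matrices; in the dual it is the other way round. A
    path to an entry below the diagonal must step down, so the dual isolates the t's and the vector
    representation the \bar t's. That q is not a root of unity enters through the q-integers,
    through q - 1/q and q + 1/q being nonzero (the latter makes odd letters square to zero), and
    through the separation of eigenvalues. *)

Section YangBaxter.
Variables (K : comNzRingType) (N : nat) (u v : 'I_N -> 'I_N -> K) (nu : K).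

(* Entry (a, b) of the matrix of t_ij (or \bar t_ij) in the vector representation;
   [dual_mx] is the analogue for its dual. *)
Definition vect_mx (w : 'I_N -> 'I_N -> K) (c : K) (p : rel nat) (i j a b : 'I_N) : K :=
  (i == j)%:R * (a == b)%:R * w i a
  + c * (p i j)%:R * (a == j)%:R * (b == i)%:R.

Definition dual_mx (w : 'I_N -> 'I_N -> K) (c : K) (p : rel nat) (i j a b : 'I_N) : K :=
  (i == j)%:R * (a == b)%:R * w i a
  + c * (p i j)%:R * (a == i)%:R * (b == j)%:R.

(* R X_1 Y_2 = Y_2 X_1 R in coordinates, where R has diagonal entries u i k and
   entry nu in position ((i, k), (k, i)) for k < i. *)
Definition yang_baxter (X Y : 'I_N -> 'I_N -> 'I_N -> 'I_N -> K) : Prop :=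
  forall i j k l a b,
    u i k * (\sum_c X i j a c * Y k l c b)
    + nu * (k < i)%N%:R * (\sum_c X k j a c * Y i l c b)
  = u j l * (\sum_c Y k l a c * X i j c b)
    + nu * (j < l)%N%:R * (\sum_c Y k j a c * X i l c b).

Hypothesis u_sym : forall i k, u i k = u k i.
Hypothesis v_sym : forall i k, v i k = v k i.
Hypothesis uv_neq : forall i k, i != k -> v i k = u i k.
Hypothesis uv1 : forall i k, u i k * v i k = 1.
Hypothesis uv_nu : forall i, u i i = v i i + nu.

Lemma sum_delta (e : 'I_N) (F : 'I_N -> K) : \sum_x (x == e)%:R * F x = F e.
Proof.
rewrite (bigD1 e) //= eqxx mul1r big1 ?addr0 // => x xe.
by rewrite (negbTE xe) mul0r.
Qed.

Lemma sum_vect_mx w w' c c' p p' i j k l a b :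
  \sum_e vect_mx w c p i j a e * vect_mx w' c' p' k l e b =
  (i == j)%:R * w i a * vect_mx w' c' p' k l a b
  + c * (p i j)%:R * (a == j)%:R * vect_mx w' c' p' k l i b.
Proof.
rewrite -(sum_delta a (fun e => (i == j)%:R * w i a * vect_mx w' c' p' k l e b)).
rewrite -(sum_delta i (fun e => c * (p i j)%:R * (a == j)%:R * vect_mx w' c' p' k l e b)).
rewrite -big_split /=; apply: eq_bigr => e _.
by rewrite {1}/vect_mx (eq_sym a e); ring.
Qed.

Lemma sum_dual_mx w w' c c' p p' i j k l a b :
  \sum_e dual_mx w c p i j a e * dual_mx w' c' p' k l e b =
  (i == j)%:R * w i a * dual_mx w' c' p' k l a b
  + c * (p i j)%:R * (a == i)%:R * dual_mx w' c' p' k l j b.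
Proof.
rewrite -(sum_delta a (fun e => (i == j)%:R * w i a * dual_mx w' c' p' k l e b)).
rewrite -(sum_delta j (fun e => c * (p i j)%:R * (a == i)%:R * dual_mx w' c' p' k l e b)).
rewrite -big_split /=; apply: eq_bigr => e _.
by rewrite {1}/dual_mx (eq_sym a e); ring.
Qed.

Lemma ltn_neq (x y : 'I_N) : x != y ->
  ((x < y)%N = true /\ (y < x)%N = false) \/ ((x < y)%N = false /\ (y < x)%N = true).
Proof. by rewrite -(inj_eq val_inj) /=; case: ltngtP => // _ _; [left|right]. Qed.

(** Once [u i i] is replaced by [v i i + nu], each case of the Yang-Baxter equation is a polynomial
    identity modulo this relation and the Hecke relation [v_sq]. *)
Fact u_sq i1 i2 : i1 != i2 -> u i1 i2 * u i1 i2 = 1.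
Proof. by move=> ne; rewrite -{2}uv_neq // uv1. Qed.

Fact v_sq i1 : v i1 i1 * v i1 i1 = 1 - nu * v i1 i1.
Proof. by have := uv1 i1 i1; rewrite uv_nu => <-; ring. Qed.

Ltac split_eq x y := let H := fresh "ne" in have [H|H] := eqVneq x y; [subst x|].

Ltac rewrite_neqs := repeat match goal with
  | H : is_true (?x != ?y) |- context [?x == ?y] => rewrite (negbTE H)
  | H : is_true (?x != ?y) |- context [?y == ?x] => rewrite (eq_sym y x) (negbTE H)
  end.

Ltac eval_deltas := rewrite ?ltnn ?eqxx; rewrite_neqs; rewrite /=.

Ltac split_orders := repeat match goal with
  | H : is_true (?x != ?y) |- context [(nat_of_ord ?x < nat_of_ord ?y)%N] =>
     let h1 := fresh in let h2 := fresh in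
     have [[h1 h2]|[h1 h2]] := ltn_neq H; rewrite ?h1 ?h2
  | H : is_true (?x != ?y) |- context [(nat_of_ord ?y < nat_of_ord ?x)%N] =>
     let h1 := fresh in let h2 := fresh in
     have [[h1 h2]|[h1 h2]] := ltn_neq H; rewrite ?h1 ?h2
  end; rewrite /=; try (exfalso; lia).

Ltac normalize_u := repeat match goal with
  | H : is_true (?x != ?y) |- context [v ?x ?y] => rewrite (uv_neq H)
  | H : is_true (?x != ?y) |- context [v ?y ?x] => rewrite (v_sym y x)
  | H : is_true (?x != ?y) |- context [u ?y ?x] => rewrite (u_sym y x)
  end.

(* All terms vanish unless j lies in the listed indices: by weight conservation
   both sides are zero unless {j, l, b} = {i, k, a} as multisets (for the dual, a
   and b are exchanged). *)
Ltac among2 j x y :=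
  let n1 := fresh in let n2 := fresh in
  case: (eqVneq j x) => [?|n1]; [subst j|
  case: (eqVneq j y) => [?|n2]; [subst j; clear n1|by eval_deltas; ring]].

Ltac among3 j x y z :=
  let n1 := fresh in let n2 := fresh in let n3 := fresh in
  case: (eqVneq j x) => [?|n1]; [subst j|
  case: (eqVneq j y) => [?|n2]; [subst j; clear n1|
  case: (eqVneq j z) => [?|n3]; [subst j; clear n1 n2|by eval_deltas; ring]]].

Ltac yb_two x y ne j l b :=
  among2 j x y; among2 l x y; among2 b x y;
  eval_deltas; try ring; split_orders; normalize_u; rewrite ?uv_nu;
  try ring: (v_sq x) (v_sq y) (u_sq ne).

Ltac yb_three x y z ne1 ne2 ne3 j l b :=
  among3 j x y z; among3 l x y z; among3 b x y z;
  eval_deltas; try ring; split_orders; normalize_u; rewrite ?uv_nu;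
  try ring: (v_sq x) (v_sq y) (v_sq z) (u_sq ne1) (u_sq ne2) (u_sq ne3).

(** Weight conservation leaves only the labels i, k, a, so there are finitely many cases: the
    coincidences among these three and, for distinct labels, their order. *)
Ltac solve_yb i j k l a b :=
 rewrite ?sum_vect_mx ?sum_dual_mx /vect_mx /dual_mx;
 let ne1 := fresh "ne" in  let ne2 := fresh "ne" in  let ne3 := fresh "ne" in
 have [|ne1] := eqVneq k i; [move=> ?; subst k|];
 [have [|ne1] := eqVneq a i; [move=> ?; subst a|];
   [(split_eq j i; [|by eval_deltas; ring]);
    (split_eq l i; [|by eval_deltas; ring]);
    (split_eq b i; [|by eval_deltas; ring]);
    eval_deltas; rewrite ?uv_nu; ring: (v_sq i)
   |yb_two a i ne1 j l b]
 |have [|ne2] := eqVneq a i;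
   [move=> ?; subst a|have [|ne3] := eqVneq a k; [move=> ?; subst a|]];
   [yb_two k i ne1 j l b|yb_two k i ne1 j l b
   |yb_three k i a ne1 ne2 ne3 j l b]].

Local Notation low := (fun i j => j < i)%N.
Local Notation upp := (fun i j => i < j)%N.

Lemma vect_yb_tt : yang_baxter (vect_mx u nu low) (vect_mx u nu low).
Proof. move=> i j k l a b; solve_yb i j k l a b. Qed.

Lemma vect_yb_bb : yang_baxter (vect_mx v (- nu) upp) (vect_mx v (- nu) upp).
Proof. move=> i j k l a b; solve_yb i j k l a b. Qed.

Lemma vect_yb_tb : yang_baxter (vect_mx u nu low) (vect_mx v (- nu) upp).
Proof. move=> i j k l a b; solve_yb i j k l a b. Qed.

Lemma dual_yb_tt : yang_baxter (dual_mx v (- nu) low) (dual_mx v (- nu) low).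
Proof. move=> i j k l a b; solve_yb i j k l b a. Qed.

Lemma dual_yb_bb : yang_baxter (dual_mx u nu upp) (dual_mx u nu upp).
Proof. move=> i j k l a b; solve_yb i j k l b a. Qed.

Lemma dual_yb_tb : yang_baxter (dual_mx v (- nu) low) (dual_mx u nu upp).
Proof. move=> i j k l a b; solve_yb i j k l b a. Qed.
End YangBaxter.

(** * Coactions of the two representations *)

(* ['M[B]_n.+1] is only an algebra over B in the library; here the scalars are K. *)
Section MatrixAlgebra.
Variables (K : fieldType) (B : algType K) (n : nat).

Definition alg_mx : Type := 'M[B]_n.+1.
HB.instance Definition _ := GRing.NzRing.on alg_mx.

Definition alg_mx_scale (c : K) (M : alg_mx) : alg_mx := map_mx ( *:%R c) M.

Fact alg_mx_scalerA a b x : alg_mx_scale a (alg_mx_scale b x) = alg_mx_scale (a * b) x.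
Proof. by apply/matrixP=> i j; rewrite !mxE scalerA. Qed.

Fact alg_mx_scale1 : left_id 1 alg_mx_scale.
Proof. by move=> x; apply/matrixP=> i j; rewrite !mxE scale1r. Qed.

Fact alg_mx_scalerDr : right_distributive alg_mx_scale +%R.
Proof. by move=> a x y; apply/matrixP=> i j; rewrite !mxE scalerDr. Qed.

Fact alg_mx_scalerDl x : {morph alg_mx_scale^~ x : a b / a + b}.
Proof. by move=> a b; apply/matrixP=> i j; rewrite !mxE scalerDl. Qed.

HB.instance Definition _ := GRing.Zmodule_isLmodule.Build K alg_mx
  alg_mx_scalerA alg_mx_scale1 alg_mx_scalerDr alg_mx_scalerDl.

Fact alg_mx_scalerAl a (x y : alg_mx) : a *: (x * y) = a *: x * y.
Proof.
apply/matrixP=> i j; rewrite !mxE scaler_sumr; apply: eq_bigr => k _.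
by rewrite mxE scalerAl.
Qed.

HB.instance Definition _ := GRing.Lmodule_isLalgebra.Build K alg_mx alg_mx_scalerAl.

Fact alg_mx_scalerAr a (x y : alg_mx) : a *: (x * y) = x * (a *: y).
Proof.
apply/matrixP=> i j; rewrite !mxE scaler_sumr; apply: eq_bigr => k _.
by rewrite [in RHS]mxE scalerAr.
Qed.

HB.instance Definition _ := GRing.Lalgebra_isAlgebra.Build K alg_mx alg_mx_scalerAr.

Lemma alg_mxZE c (M : alg_mx) a b : (c *: M) a b = c *: M a b.
Proof. by rewrite mxE. Qed.

Lemma alg_mxDE (M M' : alg_mx) a b : (M + M') a b = M a b + M' a b.
Proof. by rewrite mxE. Qed.

Lemma alg_mxME (M M' : alg_mx) a b : (M * M') a b = \sum_c M a c * M' c b.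
Proof. by rewrite mxE. Qed.
End MatrixAlgebra.

(** * Signs: from the super relations to an ordinary R-matrix *)

Section Signs.
Variables (K : fieldType) (N : nat) (s : N.-tuple bool) (q : K).
Hypothesis q0 : q != 0.

Local Notation parity := (parity s).
Definition koszul (i j : 'I_N) : K := (-1) ^+ (parity i && parity j).
Definition rdiag (i k : 'I_N) : K := koszul i k * q_ s q i ^+ (i == k).
Definition rdiagV (i k : 'I_N) : K := koszul i k * (q_ s q i)^-1 ^+ (i == k).
Definition nu : K := q - q^-1.

Lemma q_E i : q_ s q i = if parity i then q^-1 else q.
Proof. by rewrite /q_ /d; case: (parity i). Qed.

Lemma q_neq0 i : q_ s q i != 0.
Proof. by rewrite q_E; case: ifP; rewrite ?invr_eq0. Qed.

Lemma koszulC i j : koszul i j = koszul j i.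
Proof. by rewrite /koszul andbC. Qed.

Lemma koszul_sq i j : koszul i j * koszul i j = 1.
Proof. by rewrite /koszul -expr2 sqrr_sign. Qed.

Lemma rdiag_sym i k : rdiag i k = rdiag k i.
Proof. by rewrite /rdiag koszulC; case: eqVneq => [->|ik]; rewrite ?eqxx. Qed.

Lemma rdiagV_sym i k : rdiagV i k = rdiagV k i.
Proof. by rewrite /rdiagV koszulC; case: eqVneq => [->|ik]; rewrite ?eqxx. Qed.

Lemma rdiagV_neq i k : i != k -> rdiagV i k = rdiag i k.
Proof. by rewrite /rdiag /rdiagV => /negbTE->. Qed.

Lemma rdiagK i k : rdiag i k * rdiagV i k = 1.
Proof.
rewrite /rdiag /rdiagV mulrACA koszul_sq mul1r; case: (i == k); rewrite ?mul1r //.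
by rewrite mulfV ?q_neq0.
Qed.

(** For even i the two entries are q and 1/q, for odd i they are -1/q and -q; the difference is the
    same, so a single [nu] serves both parities. *)
Lemma rdiag_nu i : rdiag i i = rdiagV i i + nu.
Proof.
rewrite /rdiag /rdiagV /nu /koszul eqxx q_E; case: (parity i) => /=; rewrite ?invrK; ring.
Qed.

(* If P is the parity operator, L_ij = P^|j| X_ij satisfies the RTT relations of
   the non-super R-matrix with diagonal entries [rdiag]; this is that form of the
   relations with the powers of P cancelled. *)
Definition super_rtt (A : algType K) (X Y : 'I_N -> 'I_N -> A) : Prop :=
  forall i j k l,
    rdiag i k *: (koszul l i * koszul l j *: (X i j * Y k l))
    + (nu * (k < i)%N%:R) *: (koszul l k * koszul l j *: (X k j * Y i l))
  = rdiag j l *: (koszul j k * koszul j l *: (Y k l * X i j))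
    + (nu * (j < l)%N%:R) *: (koszul l k * koszul l j *: (Y k j * X i l)).

(** The two forms differ by the overall sign [f]. Keeping X and Y apart covers the relations among
    the t's, among the \bar t's and the mixed ones at once. *)
Lemma super_rttE (A : algType K) (X Y : 'I_N -> 'I_N -> A) i j k l :
  (rdiag i k *: (koszul l i * koszul l j *: (X i j * Y k l))
    + (nu * (k < i)%N%:R) *: (koszul l k * koszul l j *: (X k j * Y i l))
  = rdiag j l *: (koszul j k * koszul j l *: (Y k l * X i j))
    + (nu * (j < l)%N%:R) *: (koszul l k * koszul l j *: (Y k j * X i l))) <->
  (q_ s q i ^+ (i == k) *: (X i j * Y k l)
       - (varsigma K s i j k l * q_ s q j ^+ (j == l)) *: (Y k l * X i j) =
   (varsigma K s i k k l * (q_ s q k - (q_ s q k)^-1))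
       *: ((j < l)%N%:R *: (Y k j * X i l)
             - (k < i)%N%:R *: (X k j * Y i l))).
Proof.
set f : K := koszul i k * koszul l i * koszul l j.
have f2 : f * f = 1 by rewrite /f !mulrA; ring: (koszul_sq i k) (koszul_sq l i) (koszul_sq l j).
have f0 : f != 0 by apply/eqP=> f0; move/eqP: f2; rewrite f0 mul0r eq_sym oner_eq0.
have E1 : rdiag i k * (koszul l i * koszul l j) = f * q_ s q i ^+ (i == k) by rewrite /f /rdiag; ring.
have E2 : rdiag j l * (koszul j k * koszul j l) = f * (varsigma K s i j k l * q_ s q j ^+ (j == l)).
  rewrite /f /rdiag /varsigma /koszul.
  by case: (parity i) (parity j) (parity k) (parity l) => [] [] [] [] /=; ring.
have E3 : nu * (koszul l k * koszul l j) = f * (varsigma K s i k k l * (q_ s q k - (q_ s q k)^-1)).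
  rewrite /f /rdiag /varsigma /koszul q_E /nu.
  by case: (parity i) (parity j) (parity k) (parity l) => [] [] [] [] /=; rewrite ?invrK; ring.
have E4 (b : bool) : nu * b%:R * (koszul l k * koszul l j) =
    f * (varsigma K s i k k l * (q_ s q k - (q_ s q k)^-1) * b%:R).
  by rewrite mulrAC E3 -!mulrA.
rewrite !scalerA E1 E2 !E4 -!(scalerA f) -!(scalerA _ _%:R).
split=> h.
  apply: (scalerI f0); rewrite !scalerBr; apply/eqP.
  by rewrite subr_eq addrAC -subr_eq opprK h addrC.
rewrite -!scalerDr; congr (_ *: _).
move/eqP: h; rewrite subr_eq => /eqP ->.
by rewrite scalerBr addrAC subrK addrC.
Qed.
End Signs.

(** * Stability of the RTT relations under coaction *)

Section Coactions.
Variables (K : fieldType) (n : nat) (s : n.+1.-tuple bool) (q : K).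
Hypothesis q0 : q != 0.
Variable B : algType K.
Local Notation I := 'I_n.+1.
Local Notation sgn := (koszul K s).
Local Notation uu := (rdiag s q).
Local Notation nu := (nu q).
Local Notation parity := (parity s).
Local Notation E := (alg_mx B n).

(* Matrix products of X with rho on the left and on the right, in the super tensor
   product: the first keeps column indices of X, the second row indices. *)
Definition coact_l (rho : I -> I -> I -> I -> K) (X : I -> I -> B) (i j : I) : E :=
  \matrix_(a, b) \sum_k (sgn j a * rho i k a b) *: X k j.

(** Three signs are collected: (|i|+|k|)(|k|+|j|) belongs to the super coproduct of t_ij,
    (|i|+|k|)|a| turns the super tensor product with matrix units into ordinary matrices, and |j||a|
    removes the parity operator built into [rho]. With the factors in the other order, as in
    [coact_l], the three exponents add up to |j||a| when [rho] is even. *)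
Definition sgn_r (i k j a : I) : K :=
  (-1) ^+ (((parity i (+) parity k) && (parity k (+) parity j))
           (+) ((parity i (+) parity j (+) parity k) && parity a)).

Definition coact_r (rho : I -> I -> I -> I -> K) (X : I -> I -> B) (i j : I) : E :=
  \matrix_(a, b) \sum_k (sgn_r i k j a * rho k j a b) *: X i k.

Definition even_mx (rho : I -> I -> I -> I -> K) :=
  forall i j a b, parity i (+) parity j (+) parity a (+) parity b -> rho i j a b = 0.

Section Pair.
Variables (rho sigma : I -> I -> I -> I -> K) (X Y : I -> I -> B).
Hypotheses (rho_even : even_mx rho) (sigma_even : even_mx sigma).

(** Evenness of [rho] expresses the parity of the summation index c by those of a, i and i'. The
    sign left in front is symmetric in j and l and free of i and k, hence common to the four terms
    of the relation. *)
Lemma coact_l_mul i j k l a b :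
  sgn l i * sgn l j *: (coact_l rho X i j * coact_l sigma Y k l) a b =
  sgn l a * sgn j a *:
  \sum_i' \sum_k' (\sum_c rho i i' a c * sigma k k' c b)
     *: (sgn l i' * sgn l j *: (X i' j * Y k' l)).
Proof.
rewrite mxE scaler_sumr.
transitivity (\sum_c \sum_i' \sum_k' (sgn l a * sgn j a * (rho i i' a c * sigma k k' c b))
     *: (sgn l i' * sgn l j *: (X i' j * Y k' l))).
  apply: eq_bigr => c _; rewrite !mxE mulr_suml scaler_sumr.
  apply: eq_bigr => i' _; rewrite mulr_sumr scaler_sumr.
  apply: eq_bigr => k' _; rewrite -scalerAl -scalerAr !scalerA; congr (_ *: _).
  case p : (parity i (+) parity i' (+) parity a (+) parity c).
    by rewrite (rho_even p); ring.
  have -> : sgn l c = sgn l a * sgn l i * sgn l i'.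
    rewrite /sgn; move: p.
    by case: (parity i) (parity i') (parity a) (parity c) (parity l) => [] [] [] [] [] //= _; ring.
  transitivity (sgn l i * sgn l i * (sgn l a * sgn j a * (rho i i' a c * sigma k k' c b)
    * (sgn l i' * sgn l j))); first by ring.
  by rewrite koszul_sq mul1r.
rewrite exchange_big scaler_sumr; apply: eq_bigr => i' _.
rewrite exchange_big scaler_sumr; apply: eq_bigr => k' _.
by rewrite scalerA mulr_sumr scaler_suml.
Qed.

(** Besides a, only the sums |i|+|k|, |j|+|l| and |j'|+|l'| enter, so the sign is unchanged when the
    indices within a pair are exchanged and is common to the four terms of the relation. *)
Definition sgn_rr (i j k l j' l' a : I) : K :=
  (-1) ^+ (((parity i (+) parity k) && (parity j (+) parity l (+) parity j' (+) parity l'))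
           (+) (parity j' (+) parity l')
           (+) ((parity j (+) parity l) && (parity j' (+) parity l'))
           (+) ((parity i (+) parity k (+) parity j (+) parity l (+) parity j' (+) parity l')
               && parity a)).

Lemma coact_r_mul i j k l a b :
  sgn l i * sgn l j *: (coact_r rho X i j * coact_r sigma Y k l) a b =
  \sum_j' \sum_l' (sgn_rr i j k l j' l' a * \sum_c rho j' j a c * sigma l' l c b)
     *: (sgn l' i * sgn l' j' *: (X i j' * Y k l')).
Proof.
rewrite mxE scaler_sumr.
transitivity (\sum_c \sum_j' \sum_l'
     (sgn_rr i j k l j' l' a * (rho j' j a c * sigma l' l c b))
     *: (sgn l' i * sgn l' j' *: (X i j' * Y k l'))).
  apply: eq_bigr => c _; rewrite !mxE mulr_suml scaler_sumr.
  apply: eq_bigr => j' _; rewrite mulr_sumr scaler_sumr.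
  apply: eq_bigr => l' _; rewrite -scalerAl -scalerAr !scalerA; congr (_ *: _).
  case p : (parity j' (+) parity j (+) parity a (+) parity c).
    by rewrite (rho_even p); ring.
  transitivity (sgn l i * sgn l j * sgn_r i j' j a * sgn_r k l' l c
    * (rho j' j a c * sigma l' l c b)); first by ring.
  transitivity (sgn_rr i j k l j' l' a * sgn l' i * sgn l' j'
    * (rho j' j a c * sigma l' l c b)); last by ring.
  congr (_ * _); rewrite /sgn_rr /sgn_r /koszul -!signr_addb; congr (_ ^+ nat_of_bool _); move: p.
  by case: (parity i) (parity j) (parity k) (parity l) (parity j') (parity l')
    (parity a) (parity c) => [] [] [] [] [] [] [] [].
rewrite exchange_big; apply: eq_bigr => j' _.
rewrite exchange_big; apply: eq_bigr => l' _.
by rewrite mulr_sumr scaler_suml.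
Qed.
End Pair.

Lemma sum2_comb (S c d : K) (F G : I -> I -> K) (Z Z' : I -> I -> B) :
  c *: (S *: \sum_x \sum_y F x y *: Z x y) + d *: (S *: \sum_x \sum_y G x y *: Z' x y) =
  S *: \sum_x \sum_y ((c * F x y) *: Z x y + (d * G x y) *: Z' x y).
Proof.
rewrite !scalerA ![_ * S]mulrC -!scalerA -scalerDr; congr (_ *: _).
rewrite !scaler_sumr -big_split; apply: eq_bigr => x _.
rewrite !scaler_sumr -big_split; apply: eq_bigr => y _.
by rewrite !scalerA.
Qed.

(** Up to signs, R rho_1 sigma_2 X_1 Y_2 = sigma_2 rho_1 R X_1 Y_2 = sigma_2 rho_1 Y_2 X_1 R: the
    Yang-Baxter equation is applied first, then the relation between X and Y. *)
Lemma super_rtt_coact_l rho sigma X Y : even_mx rho -> even_mx sigma ->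
  yang_baxter uu nu rho sigma -> super_rtt s q X Y ->
  super_rtt s q (coact_l rho X) (coact_l sigma Y).
Proof.
move=> re se yb XY i j k l; apply/matrixP => a b.
rewrite !alg_mxDE !(alg_mxZE _ (_ *: _)) !(alg_mxZE _ (_ * _)) !coact_l_mul //.
rewrite [sgn j a * _]mulrC !sum2_comb; congr (_ *: _).
pose Z i' k' := sgn l i' * sgn l j *: (X i' j * Y k' l).
pose G k k' i i' := \sum_c sigma k k' a c * rho i i' c b.
transitivity (\sum_i' \sum_k'
    (uu i' k' * G k k' i i' + nu * (i' < k')%N%:R * G k i' i k') *: Z i' k').
  apply: eq_bigr => i' _; apply: eq_bigr => k' _.
  by rewrite -scalerDl; congr (_ *: _); apply: yb.
transitivity (\sum_k' \sum_i' G k k' i i' *: (uu i' k' *: Z i' k' +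
   (nu * (k' < i')%N%:R) *: (sgn l k' * sgn l j *: (X k' j * Y i' l)))).
  under eq_bigr => i' _ do under eq_bigr => k' _ do rewrite scalerDl.
  under eq_bigr => i' _ do rewrite big_split /=.
  under [RHS]eq_bigr => i' _ do under eq_bigr => k' _ do rewrite scalerDr.
  under [RHS]eq_bigr => i' _ do rewrite big_split /=.
  rewrite !big_split /=; congr (_ + _).
    rewrite exchange_big; apply: eq_bigr => k' _; apply: eq_bigr => i' _.
    by rewrite scalerA mulrC.
  by apply: eq_bigr => k' _; apply: eq_bigr => i' _; rewrite scalerA mulrC.
apply: eq_bigr => k' _; apply: eq_bigr => i' _.
by rewrite XY scalerDr !scalerA ![G _ _ _ _ * _]mulrC.
Qed.

(** Here X precedes [rho], so the two moves come in the other order: R X_1 Y_2 rho_1 sigma_2 = Y_2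
    X_1 R rho_1 sigma_2 = Y_2 X_1 sigma_2 rho_1 R. *)
Lemma super_rtt_coact_r rho sigma X Y : even_mx rho -> even_mx sigma ->
  yang_baxter uu nu rho sigma -> super_rtt s q X Y ->
  super_rtt s q (coact_r rho X) (coact_r sigma Y).
Proof.
move=> re se yb XY i j k l; apply/matrixP => a b.
rewrite !alg_mxDE !(alg_mxZE _ (_ *: _)) !(alg_mxZE _ (_ * _)) !coact_r_mul //.
pose F j' j l' l := \sum_c rho j' j a c * sigma l' l c b.
pose G l' l j' j := \sum_c sigma l' l a c * rho j' j c b.
pose e j' l' := sgn_rr i j k l j' l' a.
have eC j' l' : e j' l' = e l' j'.
  rewrite /e /sgn_rr; congr (_ ^+ nat_of_bool _).
  by case: (parity i) (parity j) (parity k) (parity l) (parity j') (parity l')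
    (parity a) => [] [] [] [] [] [] [].
have e1 j' l' : sgn_rr k j i l j' l' a = e j' l'.
  rewrite /e /sgn_rr; congr (_ ^+ nat_of_bool _).
  by case: (parity i) (parity j) (parity k) (parity l) (parity j') (parity l')
    (parity a) => [] [] [] [] [] [] [].
have e2 j' l' : sgn_rr k l i j l' j' a = e j' l'.
  rewrite /e /sgn_rr; congr (_ ^+ nat_of_bool _).
  by case: (parity i) (parity j) (parity k) (parity l) (parity j') (parity l')
    (parity a) => [] [] [] [] [] [] [].
pose W l' j' := sgn j' k * sgn j' l' *: (Y k l' * X i j').
transitivity (\sum_j' \sum_l' (e j' l' * F j' j l' l) *:
    (uu i k *: (sgn l' i * sgn l' j' *: (X i j' * Y k l'))
   + (nu * (k < i)%N%:R) *: (sgn l' k * sgn l' j' *: (X k j' * Y i l')))).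
  rewrite !scaler_sumr -big_split; apply: eq_bigr => j' _.
  rewrite !scaler_sumr -big_split; apply: eq_bigr => l' _.
  by rewrite e1 scalerDr !scalerA -!mulrA; congr (_ *: _ + _ *: _); rewrite -/(F _ _ _ _) /e; ring.
transitivity (\sum_j' \sum_l' (e j' l' *
    (uu j' l' * F j' j l' l + nu * (l' < j')%N%:R * F l' j j' l)) *: W l' j').
  under eq_bigr => j' _ do under eq_bigr => l' _ do rewrite XY scalerDr.
  under eq_bigr => j' _ do rewrite big_split /=.
  under [RHS]eq_bigr => j' _ do under eq_bigr => l' _ do rewrite mulrDr scalerDl.
  under [RHS]eq_bigr => j' _ do rewrite big_split /=.
  rewrite !big_split /=; congr (_ + _).
    apply: eq_bigr => j' _; apply: eq_bigr => l' _.
    by rewrite scalerA -mulrA [F _ _ _ _ * _]mulrC.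
  rewrite exchange_big; apply: eq_bigr => j' _; apply: eq_bigr => l' _.
  by rewrite scalerA eC -mulrA [F _ _ _ _ * _]mulrC.
transitivity (\sum_j' \sum_l' (e j' l' *
    (uu j l * G l' l j' j + nu * (j < l)%N%:R * G l' j j' l)) *: W l' j').
  apply: eq_bigr => j' _; apply: eq_bigr => l' _; congr (_ * _ *: _).
  exact: yb.
rewrite !scaler_sumr exchange_big -big_split; apply: eq_bigr => l' _.
rewrite !scaler_sumr -big_split; apply: eq_bigr => j' _.
rewrite e2 -/(G _ _ _ _).
have -> : sgn_rr k j i l l' j' a = e j' l' by rewrite e1 eC.
by rewrite /W mulrDr scalerDl !scalerA; congr (_ *: _ + _ *: _); rewrite -/(G _ _ _ _); ring.
Qed.
End Coactions.

(** * The two homomorphisms from Uq to matrices over Uq *)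

Section Homs.
Variables (K : fieldType) (n : nat) (s : n.+1.-tuple bool) (q : K).
Hypothesis q0 : q != 0.
Local Notation I := 'I_n.+1.
Local Notation sgn := (koszul K s).
Local Notation uu := (rdiag s q).
Local Notation vv := (rdiagV s q).
Local Notation nu := (nu q).
Local Notation parity := (parity s).
Local Notation U := (Uq s q).
Local Notation E := (alg_mx U n).
Local Notation t := (t s q).
Local Notation tbar := (tbar s q).

Section Generic.
Variable A : algType K.

Lemma super_rtt_rel (T Tb : I -> I -> A) :
  (forall i, T i i * Tb i i = 1) -> (forall i, Tb i i * T i i = 1) ->
  super_rtt s q T T -> super_rtt s q Tb Tb -> super_rtt s q T Tb ->
  forall x y, rtt_rel s q T Tb x y -> x = y.
Proof.
have D (i j k l : I) (c : K) (Y X : I -> I -> A) :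
   c *: ((j < l)%N%:R *: (Y k j * X i l) - (k < i)%N%:R *: (Y k j * X i l)) =
   (c * ((j < l)%N%:R - (k < i)%N%:R)) *: (Y k j * X i l).
  by rewrite -scalerBl scalerA.
move=> TTb TbT tt bb tb x y [i|i|i j k l|i j k l|i j k l] //.
- by have /super_rttE := tt i j k l; rewrite D.
- by have /super_rttE := bb i j k l; rewrite D.
- by have /super_rttE := tb i j k l.
Qed.
End Generic.

Lemma super_rtt_tt : super_rtt s q t t.
Proof.
by move=> i j k l; apply/super_rttE; rewrite -scalerBl scalerA; apply/Uq_rel/rtt_tt.
Qed.

Lemma super_rtt_bb : super_rtt s q tbar tbar.
Proof.
by move=> i j k l; apply/super_rttE; rewrite -scalerBl scalerA; apply/Uq_rel/rtt_bb.
Qed.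

Lemma super_rtt_tb : super_rtt s q t tbar.
Proof. by move=> i j k l; apply/super_rttE/Uq_rel/rtt_tb. Qed.

Lemma tK i : t i i * tbar i i = 1.
Proof. exact/Uq_rel/rtt_inv_r. Qed.

Lemma tbarK i : tbar i i * t i i = 1.
Proof. exact/Uq_rel/rtt_inv_l. Qed.

Lemma vect_mx_even (w : I -> I -> K) c p : even_mx s (vect_mx w c p).
Proof.
move=> i j a b par; rewrite /vect_mx.
have -> : (i == j)%:R * (a == b)%:R = 0 :> K.
  case: eqP => [ij|_]; case: eqP => [ab|_]; rewrite ?mul0r ?mulr0 //.
  by move: par; rewrite ij ab addbb addFb addbb.
rewrite mul0r add0r -mulrA; have -> : (a == j)%:R * (b == i)%:R = 0 :> K.
  case: eqP => [aj|_]; case: eqP => [bi|_]; rewrite ?mul0r ?mulr0 //.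
  by move: par; rewrite aj bi addbK addbb.
by rewrite mulr0.
Qed.

Lemma dual_mx_even (w : I -> I -> K) c p : even_mx s (dual_mx w c p).
Proof.
move=> i j a b par; rewrite /dual_mx.
have -> : (i == j)%:R * (a == b)%:R = 0 :> K.
  case: eqP => [ij|_]; case: eqP => [ab|_]; rewrite ?mul0r ?mulr0 //.
  by move: par; rewrite ij ab addbb addFb addbb.
rewrite mul0r add0r -mulrA; have -> : (a == i)%:R * (b == j)%:R = 0 :> K.
  case: eqP => [ai|_]; case: eqP => [bj|_]; rewrite ?mul0r ?mulr0 //.
  by move: par; rewrite ai bj [parity i (+) _]addbC addbK addbb.
by rewrite mulr0.
Qed.

Lemma sum_delta_scale (V : lmodType K) (e : I) (v : V) : \sum_k (k == e)%:R *: v = v.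
Proof.
rewrite (bigD1 e) //= eqxx scale1r big1 ?addr0 // => x xe.
by rewrite (negbTE xe) scale0r.
Qed.

Lemma coact_lE (A : algType K) w c p (X : I -> I -> A) i j a b : irreflexive p ->
  coact_l s (vect_mx w c p) X i j a b =
  if a == b then (sgn j a * w i a) *: X i j
  else if (b == i) && p b a then (sgn j a * c) *: X a j else 0.
Proof.
move=> pxx; rewrite mxE /vect_mx.
transitivity (\sum_k ((k == i)%:R *: ((sgn j a * ((a == b)%:R * w i a)) *: X i j)
   + (k == a)%:R *: ((sgn j a * (c * (p i a)%:R * (b == i)%:R)) *: X a j))).
  apply: eq_bigr => k _; rewrite !scalerA mulrDr scalerDl (eq_sym a k) (eq_sym i k).
  congr (_ + _).
    by have [->|_] := eqVneq k i; rewrite ?mul1r // !(mul0r, mulr0) !scale0r.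
  by have [->|_] := eqVneq k a; rewrite ?mul1r ?mulr1 // !(mul0r, mulr0) !scale0r.
rewrite big_split /= !sum_delta_scale.
have [<-|ab] := eqVneq a b.
  rewrite mul1r; have [->|_] := eqVneq a i; first by rewrite pxx !(mulr0, mul0r) scale0r addr0.
  by rewrite !mulr0 scale0r addr0.
rewrite mul0r mulr0 scale0r add0r; case: (b =P i) => [->|_] /=.
  by case: (p i a); rewrite ?mulr1 ?mulr0 ?mul0r ?mulr0 ?scale0r.
by rewrite !mulr0 scale0r.
Qed.

Lemma coact_rE (A : algType K) w c p (X : I -> I -> A) i j a b : irreflexive p ->
  coact_r s (dual_mx w c p) X i j a b =
  if a == b then (sgn i a * w j a) *: X i j
  else if (b == j) && p a b then (sgn_r K s i a j a * c) *: X i a else 0.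
Proof.
move=> pxx.
have sr k : sgn_r K s i k k a = sgn i a.
  by rewrite /sgn_r /koszul addbb andbF addFb; case: (parity k); case: (parity i).
rewrite mxE /dual_mx.
transitivity (\sum_k ((k == j)%:R *: ((sgn i a * ((a == b)%:R * w j a)) *: X i j)
   + (k == a)%:R *: ((sgn_r K s i a j a * (c * (p a j)%:R * (b == j)%:R)) *: X i a))).
  apply: eq_bigr => k _; rewrite !scalerA mulrDr scalerDl (eq_sym a k).
  congr (_ + _).
    by have [->|_] := eqVneq k j; rewrite ?mul1r ?sr // !(mul0r, mulr0) !scale0r.
  by have [->|_] := eqVneq k a; rewrite ?mul1r ?mulr1 // !(mul0r, mulr0) !scale0r.
rewrite big_split /= !sum_delta_scale.
have [<-|ab] := eqVneq a b.
  rewrite mul1r; have [->|_] := eqVneq a j; first by rewrite pxx !(mulr0, mul0r) scale0r addr0.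
  by rewrite !mulr0 scale0r addr0.
rewrite mul0r mulr0 scale0r add0r; case: (b =P j) => [->|_] /=.
  by case: (p a j); rewrite ?mulr1 ?mulr0 ?mul0r ?mulr0 ?scale0r.
by rewrite !mulr0 scale0r.
Qed.

Lemma diag_mx_inv (A : algType K) (M M' : alg_mx A n) (al be : I -> K) (x y : A) :
  (forall a b, M a b = if a == b then al a *: x else 0) ->
  (forall a b, M' a b = if a == b then be a *: y else 0) ->
  (forall a, al a * be a = 1) -> x * y = 1 -> M * M' = 1.
Proof.
move=> ME ME' ab xy; apply/matrixP => a b; rewrite alg_mxME (bigD1 a) //= big1 => [|c ca].
  rewrite addr0 ME ME' eqxx [RHS]mxE; case: (a == b); last by rewrite mulr0.
  by rewrite -scalerAl -scalerAr xy scalerA ab scale1r.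
by rewrite ME eq_sym (negbTE ca) mul0r.
Qed.

Local Notation low := (fun i j => j < i)%N.
Local Notation upp := (fun i j => i < j)%N.

(** Built from the vector representation: the images of the t's are upper triangular and those of
    the \bar t's lower triangular, so only a \bar t can lead from r down to c < r. *)
Lemma hom_l : exists f : {lrmorphism U -> E}, forall i j a b,
  f (t i j) a b = (if a == b then (sgn j a * uu i a) *: t i j
    else if (b == i) && (a < b)%N then (sgn j a * nu) *: t a j else 0) /\
  f (tbar i j) a b = (if a == b then (sgn j a * vv i a) *: tbar i j
    else if (b == i) && (b < a)%N then (sgn j a * - nu) *: tbar a j else 0).
Proof.
have t0 (i j : I) : (i < j)%N -> t i j = 0 by move=> /(t_eq0 s q) [].
have tb0 (i j : I) : (j < i)%N -> tbar i j = 0 by move=> /(t_eq0 s q) [].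
pose T := coact_l s (vect_mx uu nu low) t.
pose Tb := coact_l s (vect_mx vv (- nu) upp) tbar.
have TE (i j a b : I) := @coact_lE _ uu nu low t i j a b (fun x => ltnn x).
have TbE (i j a b : I) := @coact_lE _ vv (- nu) upp tbar i j a b (fun x => ltnn x).
(* An off-diagonal entry of T_ii could only contain t_ai with a < i, which is zero. So T_ii, and
   likewise Tb_ii, is diagonal, and the two are inverse entry by entry. *)
have Td i a b : T i i a b = if a == b then (sgn i a * uu i a) *: t i i else 0.
  rewrite TE; case: (a == b) => //; case: ifP => // /andP[/eqP -> ai].
  by rewrite t0 ?scaler0.
have Tbd i a b : Tb i i a b = if a == b then (sgn i a * vv i a) *: tbar i i else 0.
  rewrite TbE; case: (a == b) => //; case: ifP => // /andP[/eqP -> ai].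
  by rewrite tb0 ?scaler0.
have uv i a : (sgn i a * uu i a) * (sgn i a * vv i a) = 1.
  by rewrite mulrACA koszul_sq rdiagK ?mul1r.
have h0 (i j : I) : (i < j)%N -> T i j = 0 /\ Tb j i = 0.
  move=> ij; split; apply/matrixP => a b; rewrite ?TE ?TbE [RHS]mxE.
    rewrite t0 // scaler0; case: (a == b) => //; case: ifP => // /andP[/eqP -> /= ai].
    by rewrite t0 ?scaler0 // (ltn_trans ai).
  rewrite tb0 // scaler0; case: (a == b) => //; case: ifP => // /andP[/eqP -> /= ai].
  by rewrite tb0 ?scaler0 // (ltn_trans ij).
have hrel (x y : E) : rtt_rel s q T Tb x y -> x = y.
  apply: super_rtt_rel.
  + move=> i; exact: diag_mx_inv (Td i) (Tbd i) (uv i) (tK i).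
  + move=> i; apply: diag_mx_inv (Tbd i) (Td i) _ (tbarK i) => a; by rewrite mulrC.
  + apply: super_rtt_coact_l super_rtt_tt; try exact: vect_mx_even.
    apply: vect_yb_tt; [exact: rdiag_sym|exact: rdiagV_neq|exact: rdiagK|].
    exact: rdiag_nu.
  + apply: super_rtt_coact_l super_rtt_bb; try exact: vect_mx_even.
    apply: vect_yb_bb; [exact: rdiag_sym|exact: rdiagV_sym|exact: rdiagV_neq|exact: rdiagK|].
    exact: rdiag_nu.
  + apply: super_rtt_coact_l super_rtt_tb; try exact: vect_mx_even.
    apply: vect_yb_tb; [exact: rdiag_sym|exact: rdiagV_sym|exact: rdiagV_neq|exact: rdiagK|].
    exact: rdiag_nu.
have [f fE] := Uq_eval h0 hrel.
exists f => i j a b; have [-> ->] := fE i j.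
by rewrite TE TbE.
Qed.

(** Built from the dual, which exchanges the triangular shapes: now only a t can lead from r down to
    c < r. *)
Lemma hom_r : exists f : {lrmorphism U -> E}, forall i j a b,
  f (t i j) a b = (if a == b then (sgn i a * vv j a) *: t i j
    else if (b == j) && (b < a)%N then (sgn_r K s i a j a * - nu) *: t i a else 0) /\
  f (tbar i j) a b = (if a == b then (sgn i a * uu j a) *: tbar i j
    else if (b == j) && (a < b)%N then (sgn_r K s i a j a * nu) *: tbar i a else 0).
Proof.
have t0 (i j : I) : (i < j)%N -> t i j = 0 by move=> /(t_eq0 s q) [].
have tb0 (i j : I) : (j < i)%N -> tbar i j = 0 by move=> /(t_eq0 s q) [].
pose T := coact_r s (dual_mx vv (- nu) low) t.
pose Tb := coact_r s (dual_mx uu nu upp) tbar.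
have TE (i j a b : I) := @coact_rE _ vv (- nu) low t i j a b (fun x => ltnn x).
have TbE (i j a b : I) := @coact_rE _ uu nu upp tbar i j a b (fun x => ltnn x).
have Td i a b : T i i a b = if a == b then (sgn i a * vv i a) *: t i i else 0.
  rewrite TE; case: (a == b) => //; case: ifP => // /andP[/eqP -> ai].
  by rewrite t0 ?scaler0.
have Tbd i a b : Tb i i a b = if a == b then (sgn i a * uu i a) *: tbar i i else 0.
  rewrite TbE; case: (a == b) => //; case: ifP => // /andP[/eqP -> ai].
  by rewrite tb0 ?scaler0.
have uv i a : (sgn i a * vv i a) * (sgn i a * uu i a) = 1.
  by rewrite mulrACA koszul_sq mulrC mulr1 mulrC rdiagK.
have h0 (i j : I) : (i < j)%N -> T i j = 0 /\ Tb j i = 0.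
  move=> ij; split; apply/matrixP => a b; rewrite ?TE ?TbE [RHS]mxE.
    rewrite t0 // scaler0; case: (a == b) => //; case: ifP => // /andP[/eqP -> /= ai].
    by rewrite t0 ?scaler0 // (ltn_trans ij).
  rewrite tb0 // scaler0; case: (a == b) => //; case: ifP => // /andP[/eqP -> /= ai].
  by rewrite tb0 ?scaler0 // (ltn_trans ai).
have hrel (x y : E) : rtt_rel s q T Tb x y -> x = y.
  apply: super_rtt_rel.
  + move=> i; exact: diag_mx_inv (Td i) (Tbd i) (uv i) (tK i).
  + move=> i; apply: diag_mx_inv (Tbd i) (Td i) _ (tbarK i) => a; by rewrite mulrC.
  + apply: super_rtt_coact_r super_rtt_tt; try exact: dual_mx_even.
    apply: dual_yb_tt; [exact: rdiag_sym|exact: rdiagV_sym|exact: rdiagV_neq|exact: rdiagK|].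
    exact: rdiag_nu.
  + apply: super_rtt_coact_r super_rtt_bb; try exact: dual_mx_even.
    apply: dual_yb_bb; [exact: rdiag_sym|exact: rdiagV_neq|exact: rdiagK|].
    exact: rdiag_nu.
  + apply: super_rtt_coact_r super_rtt_tb; try exact: dual_mx_even.
    apply: dual_yb_tb; [exact: rdiag_sym|exact: rdiagV_sym|exact: rdiagV_neq|exact: rdiagK|].
    exact: rdiag_nu.
have [f fE] := Uq_eval h0 hrel.
exists f => i j a b; have [-> ->] := fE i j.
by rewrite TE TbE.
Qed.
End Homs.

(** * Skew derivations: reading off exponents *)

Section Proportional.
Variables (K : fieldType) (A : algType K).
Implicit Types x y z : A.

(** Most commutation scalars matter only through being nonzero; this relation spares their
    computation. *)
Definition prop_to x y := exists2 k : K, k != 0 & x = k *: y.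

Lemma prop_refl x : prop_to x x.
Proof. by exists 1; rewrite ?oner_neq0 ?scale1r. Qed.

Lemma prop_trans y x z : prop_to x y -> prop_to y z -> prop_to x z.
Proof.
move=> [k k0 ->] [l l0 ->]; exists (k * l); first by rewrite mulf_neq0.
by rewrite scalerA.
Qed.

Lemma prop_sym x y : prop_to x y -> prop_to y x.
Proof.
by move=> [k k0 ->]; exists k^-1; rewrite ?invr_eq0 // scalerA mulVf // scale1r.
Qed.

Lemma prop_mul x y x' y' : prop_to x y -> prop_to x' y' -> prop_to (x * x') (y * y').
Proof.
move=> [k k0 ->] [l l0 ->]; exists (k * l); first by rewrite mulf_neq0.
by rewrite -scalerAl -scalerAr scalerA.
Qed.

Lemma prop_scale k x : k != 0 -> prop_to (k *: x) x.
Proof. by move=> k0; exists k. Qed.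

Definition qcomm x y := prop_to (x * y) (y * x).

Lemma qcomm_sym x y : qcomm x y -> qcomm y x.
Proof. exact: prop_sym. Qed.

Lemma qcomm1 x : qcomm x 1.
Proof. by rewrite /qcomm mul1r mulr1; apply: prop_refl. Qed.

Lemma qcommM x y z : qcomm x y -> qcomm x z -> qcomm x (y * z).
Proof.
move=> xy xz; rewrite /qcomm mulrA; apply: (@prop_trans (y * x * z)).
  exact: prop_mul xy (prop_refl _).
by rewrite -!mulrA; apply: prop_mul (prop_refl _) xz.
Qed.

Lemma qcommX x y m : qcomm x y -> qcomm x (y ^+ m).
Proof.
move=> xy; elim: m => [|m IHm]; first exact: qcomm1.
by rewrite exprS; apply: qcommM.
Qed.

Lemma qcomm_prod (J : Type) x (r : seq J) (P : pred J) (F : J -> A) :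
  (forall j, P j -> qcomm x (F j)) -> qcomm x (\prod_(j <- r | P j) F j).
Proof.
by move=> h; elim/big_ind: _ => // [|y z]; [apply: qcomm1|apply: qcommM].
Qed.

Lemma prop_prod (J : Type) (r : seq J) (P : pred J) (F G : J -> A) :
  (forall j, P j -> prop_to (F j) (G j)) ->
  prop_to (\prod_(j <- r | P j) F j) (\prod_(j <- r | P j) G j).
Proof.
move=> h; elim/big_ind2: _ => //; first exact: prop_refl.
by move=> *; apply: prop_mul.
Qed.
End Proportional.

(** * Matrix entries as sums over paths *)

Section Elimination.
Variables (K : fieldType) (n : nat) (s : n.+1.-tuple bool) (q : K).
Hypotheses (q0 : q != 0) (q_nroot : forall k : nat, (0 < k)%N -> q ^+ k != 1).
Local Notation I := 'I_n.+1.
Local Notation sgn := (koszul K s).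
Local Notation vv := (rdiagV s q).
Local Notation q_ := (q_ s q).
Local Notation parity := (parity s).
Variables (A : algType K) (f : {lrmorphism A -> alg_mx A n}).

Lemma entryM x y a b : f (x * y) a b = \sum_c f x a c * f y c b.
Proof. by rewrite [f _](rmorphM f) alg_mxME. Qed.

Lemma entry1 a b : f 1 a b = (a == b)%:R.
Proof. by rewrite [f _](rmorph1 f) mxE. Qed.

(* The entry (r, c) of f (X * Y * Z) is a sum over paths from r to c, one step per
   factor. [tri], [window] and [stable_col] restrict the steps that a factor allows
   so that all the paths go straight through X and Z. *)
Definition tri (r : nat) (x : A) : Prop :=
  forall e : I, (r <= e)%N ->
    (forall d : I, (d < e)%N -> f x e d = 0) /\ prop_to (f x e e) x.

Lemma tri1 r : tri r 1.
Proof.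
move=> e _; split=> [d de|]; rewrite entry1 ?eqxx; last exact: prop_refl.
by rewrite -val_eqE /= gtn_eqF.
Qed.

Lemma triM r x y : tri r x -> tri r y -> tri r (x * y).
Proof.
move=> hx hy e re; have [x0 [k k0 xe]] := hx e re; have [y0 [l l0 ye]] := hy e re.
split=> [d de|].
  rewrite entryM big1 // => c _; case: (ltnP c e) => [ce|ec]; first by rewrite x0 ?mul0r.
  by have [y00 _] := hy c (leq_trans re ec); rewrite y00 ?mulr0 // (leq_trans de).
exists (k * l); first by rewrite mulf_neq0.
rewrite entryM (bigD1 e) //= big1 ?addr0 => [|c ce].
  by rewrite xe ye -scalerAl -scalerAr scalerA.
case: (ltnP c e) => [ltce|ec]; first by rewrite x0 ?mul0r.
have ltec : (e < c)%N by rewrite ltn_neqAle ec andbT eq_sym.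
by have [y00 _] := hy c (leq_trans re ec); rewrite y00 ?mulr0.
Qed.

Lemma triX r x m : tri r x -> tri r (x ^+ m).
Proof. by move=> hx; elim: m => [|m IHm]; [apply: tri1|rewrite exprS; apply: triM]. Qed.

Lemma tri_prod r (J : Type) (l : seq J) (P : pred J) (F : J -> A) :
  (forall j, P j -> tri r (F j)) -> tri r (\prod_(j <- l | P j) F j).
Proof. by move=> h; elim/big_ind: _ => // [|y z]; [apply: tri1|apply: triM]. Qed.

Definition window (r c : I) (x : A) : Prop :=
  forall a e : I, (e < a)%N -> (r < a)%N || (e < c)%N -> f x a e = 0.

Lemma windowM r c x y : window r c x -> window r c y -> window r c (x * y).
Proof.
move=> hx hy a e ea h; rewrite entryM big1 // => g _.
case/orP: h => [ra|ec].
  case: (ltnP g a) => ga; first by rewrite hx ?mul0r ?ra.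
  by rewrite hy ?mulr0 ?(leq_trans ea ga) ?(leq_trans ra ga).
case: (leqP g e) => ge; last by rewrite hy ?mulr0 ?ec ?orbT.
by rewrite hx ?mul0r ?(leq_ltn_trans ge ea) // (leq_ltn_trans ge ec) orbT.
Qed.

Lemma window1 r c : window r c 1.
Proof. by move=> a e ea _; rewrite entry1 -val_eqE /= gtn_eqF. Qed.

Lemma windowX r c x m : window r c x -> window r c (x ^+ m).
Proof. by move=> hx; elim: m => [|m IHm]; [apply: window1|rewrite exprS; apply: windowM]. Qed.

Lemma window_prod r c (J : Type) (l : seq J) (P : pred J) (F : J -> A) :
  (forall j, P j -> window r c (F j)) -> window r c (\prod_(j <- l | P j) F j).
Proof. by move=> h; elim/big_ind: _ => // [|y z]; [apply: window1|apply: windowM]. Qed.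

Definition stable_col (c : I) (x : A) : Prop :=
  (forall g : I, g != c -> f x g c = 0) /\ prop_to (f x c c) x.

Lemma stable_col1 c : stable_col c 1.
Proof.
by split=> [g gc|]; rewrite entry1 ?eqxx ?(negbTE gc) //; apply: prop_refl.
Qed.

Lemma stable_colM c x y : stable_col c x -> stable_col c y -> stable_col c (x * y).
Proof.
move=> [x0 [k k0 xe]] [y0 [l l0 ye]]; split=> [g gc|].
  rewrite entryM (bigD1 c) //= big1 ?addr0 => [|h hc]; last by rewrite y0 ?mulr0.
  by rewrite x0 ?mul0r.
exists (k * l); first by rewrite mulf_neq0.
rewrite entryM (bigD1 c) //= big1 ?addr0 => [|h hc]; last by rewrite y0 ?mulr0.
by rewrite xe ye -scalerAl -scalerAr scalerA.
Qed.

Lemma stable_colX c x m : stable_col c x -> stable_col c (x ^+ m).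
Proof. by move=> hx; elim: m => [|m IHm]; [apply: stable_col1|rewrite exprS; apply: stable_colM]. Qed.

Lemma stable_col_prod c (J : Type) (l : seq J) (P : pred J) (F : J -> A) :
  (forall j, P j -> stable_col c (F j)) -> stable_col c (\prod_(j <- l | P j) F j).
Proof. by move=> h; elim/big_ind: _ => // [|y z]; [apply: stable_col1|apply: stable_colM]. Qed.

(** X makes no step down from r. A path leaving X above r would be stuck there, since Y does not
    descend from above r and Z never descends; so it leaves X at r. It must enter Z at or below c,
    and Y does not descend below c. *)
Lemma entry_split (r c : I) X Y Z : (c < r)%N -> tri r X -> window r c Y -> tri 0 Z ->
  f (X * Y * Z) r c = f X r r * f Y r c * f Z c c.
Proof.
move=> cr hX hY hZ.
have XY (e : I) : (e <= c)%N -> f (X * Y) r e = f X r r * f Y r e.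
  move=> ec; rewrite entryM (bigD1 r) //= big1 ?addr0 // => d dr.
  case: (ltnP d r) => [dltr|rd]; first by have [X0 _] := hX r (leqnn _); rewrite X0 ?mul0r.
  have {}rd : (r < d)%N by rewrite ltn_neqAle rd andbT eq_sym.
  by rewrite hY ?mulr0 ?rd // (leq_ltn_trans ec) // (ltn_trans cr).
rewrite entryM (bigD1 c) //= XY // big1 ?addr0 // => e ec.
case: (ltnP e c) => [ltec|ce].
  by rewrite XY 1?ltnW // hY ?ltec ?orbT ?(ltn_trans ltec) // mulr0 mul0r.
have [Z0 _] := hZ e (leq0n _); rewrite Z0 ?mulr0 //.
by rewrite ltn_neqAle ce andbT eq_sym.
Qed.

(** Used with x_ij = t_ij under [hom_r] and with x_ij = \bar t_ji under [hom_l]; with this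
    transposition both families satisfy the same hypotheses. *)
Variables (x : I -> I -> A) (o : I -> I -> I -> K).
Hypothesis x_tri : forall i j : I, (i < j)%N -> x i j = 0.
Hypothesis o_neq0 : forall i j a, o i a j != 0.
Hypothesis x_off : forall i j a b, a != b ->
  f (x i j) a b = if (b == j) && (b < a)%N then o i a j *: x i a else 0.
Hypothesis x_diag : forall i j a, f (x i j) a a = (sgn i a * vv j a) *: x i j.
Hypothesis x_mu : forall r c : I, (c < r)%N ->
  x r r * x r c = (q_ r)^-1 *: (x r c * x r r).

Lemma koszul_neq0 i j : sgn i j != 0.
Proof. by rewrite /koszul signr_eq0. Qed.

Lemma rdiagV_neq0 i j : vv i j != 0.
Proof. by rewrite /rdiagV mulf_neq0 ?koszul_neq0 // expf_neq0 // invr_eq0 q_neq0. Qed.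

Lemma x_diag_prop i j a : prop_to (f (x i j) a a) (x i j).
Proof. by rewrite x_diag; apply: prop_scale; rewrite mulf_neq0 ?koszul_neq0 ?rdiagV_neq0. Qed.

Lemma tri_x (r i j : I) : (i < r)%N -> tri r (x i j).
Proof.
move=> ir e re; split=> [d de|]; last exact: x_diag_prop.
rewrite x_off; last by rewrite -val_eqE /= gtn_eqF.
by case: ifP => // _; rewrite x_tri ?scaler0 // (leq_trans ir).
Qed.

Lemma window_x (r c j : I) : (c <= j)%N -> window r c (x r j).
Proof.
move=> cj a e ea h; rewrite x_off; last by rewrite -val_eqE /= gtn_eqF.
case: ifP => // /andP[/eqP ej _]; case/orP: h => [ra|]; first by rewrite x_tri ?scaler0.
by rewrite ej ltnNge cj.
Qed.

Lemma stable_col_x (r c j : I) : j != c -> stable_col c (x r j).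
Proof.
move=> jc; split=> [g gc|]; last exact: x_diag_prop.
by rewrite x_off // eq_sym (negbTE jc).
Qed.

(** Coefficient of the entry (r, c) of x_rc^m, by the first letter: either it stays at r, or it
    steps to c, leaving x_rr; then the other letters stay at c and x_rr moves right past them, at
    the cost of 1/q_r for each. *)
Fixpoint kappa (r c : I) (m : nat) : K :=
  if m is m'.+1 then sgn r r * vv c r * kappa r c m'
    + o r r c * (sgn r c * vv c c * (q_ r)^-1) ^+ m'
  else 0.

Lemma entry_diag_pow (i j a : I) m : ~~ ((j < a)%N) ->
  f (x i j ^+ m) a a = (sgn i a * vv j a) ^+ m *: x i j ^+ m.
Proof.
move=> ja; elim: m => [|m IHm]; first by rewrite !expr0 entry1 eqxx scale1r.
rewrite !exprS entryM (bigD1 a) //= big1 ?addr0 => [|g ga].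
  by rewrite x_diag IHm -scalerAl -scalerAr scalerA.
have ag : a != g by rewrite eq_sym.
rewrite x_off //; case: ifP => [/andP[/eqP gj lt_ga]|]; last by rewrite mul0r.
by rewrite -gj lt_ga in ja.
Qed.

Lemma xrr_pow (r c : I) m : (c < r)%N ->
  x r r * x r c ^+ m = (q_ r)^-1 ^+ m *: (x r c ^+ m * x r r).
Proof.
move=> cr; elim: m => [|m IHm]; first by rewrite !expr0 mulr1 mul1r scale1r.
by rewrite !exprSr mulrA IHm -scalerAl -(mulrA _ (x r r)) x_mu // -scalerAr scalerA mulrA.
Qed.

Lemma entry_pow (r c : I) m : (c < r)%N ->
  f (x r c ^+ m) r c = kappa r c m *: (x r c ^+ m.-1 * x r r).
Proof.
move=> cr; have rc : r != c by rewrite -val_eqE /= gtn_eqF.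
elim: m => [|m IHm]; first by rewrite expr0 entry1 (negbTE rc) scale0r.
rewrite exprS entryM (bigD1 r) //= (bigD1 c) 1?eq_sym //= big1 ?addr0; last first.
  move=> g /andP[gr gc]; have rg : r != g by rewrite eq_sym.
  by rewrite x_off // (negbTE gc) mul0r.
rewrite x_diag IHm x_off // eqxx cr /= entry_diag_pow ?ltnn //.
rewrite [kappa _ _ _]/= scalerDl -!scalerAl -!scalerAr !scalerA; congr (_ + _).
  case: m IHm => [|m] _; first by rewrite /= mulr0 !scale0r.
  by rewrite (mulrA (x r c)) -exprS.
by rewrite xrr_pow // scalerA [in RHS]exprMn -(mulrA (o _ _ _)).
Qed.

(* For r and c of the same parity kappa is, up to a unit, the sum of the first m
   powers of q_r^-2, a q-integer. *)
Lemma kappa_neq0 (r c : I) m : (c < r)%N -> (0 < m)%N ->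
  (parity r (+) parity c ==> (m <= 1)%N) -> kappa r c m != 0.
Proof.
move=> cr m0 hm; have rc : c != r by rewrite -val_eqE /= ltn_eqF.
case: m m0 hm => // -[|m] _; first by rewrite /= mulr0 add0r expr0 mulr1 o_neq0.
rewrite implybF addbC negb_add => /eqP pcr.
have e1 : sgn r r * vv c r = 1.
  by rewrite /rdiagV (negbTE rc) expr0 mulr1 /koszul pcr -expr2 sqrr_sign.
set w := sgn r c * vv c c * (q_ r)^-1.
have wE : w = (q_ r ^+ 2)^-1.
  rewrite /w /rdiagV eqxx expr1 mulrA /koszul pcr -expr2 sqrr_sign mul1r.
  by rewrite expr2 invfM /Defs.q_ /d pcr.
(* The geometric sum with ratio w = q_r^-2, without division by w - 1. *)
have kE k : (w - 1) * kappa r c k = o r r c * (w ^+ k - 1).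
  elim: k => [|k IHk]; first by rewrite /= mulr0 expr0 subrr mulr0.
  by rewrite /= e1 mul1r mulrDr IHk -/w exprS; ring.
apply/eqP => k0; have := kE m.+2; rewrite k0 mulr0 => /esym/eqP.
rewrite mulf_eq0 (negbTE (o_neq0 _ _ _)) subr_eq0 /= wE exprVn invr_eq1 -exprM.
rewrite q_E; case: ifP => _; rewrite ?exprVn ?invr_eq1; apply/negP/q_nroot; lia.
Qed.

(** A step into c requires a letter with second index c. Y has no such step by [stable_col], so the
    path reaches c inside x_rc^m, where [kappa] counts the possibilities. *)
Lemma entry_row (r c : I) X m Y Z : (c < r)%N ->
  tri r X -> window r c Y -> stable_col c Y -> tri 0 Z ->
  (parity r (+) parity c ==> (m <= 1)%N) ->
  if (0 < m)%N then
    prop_to (f (X * (x r c ^+ m * Y) * Z) r c) (X * (x r c ^+ m.-1 * x r r * Y) * Z)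
  else f (X * (x r c ^+ m * Y) * Z) r c = 0.
Proof.
move=> cr hX wY sY hZ hm.
have wxY : window r c (x r c ^+ m * Y) by apply: windowM wY; apply/windowX/window_x.
rewrite (entry_split cr hX wxY hZ).
have -> : f (x r c ^+ m * Y) r c = kappa r c m *: (x r c ^+ m.-1 * x r r) * f Y c c.
  rewrite entryM (bigD1 c) //= big1 ?addr0 ?entry_pow // => g gc.
  by rewrite (sY.1 _ gc) mulr0.
case: ifP => [m0|/negbT]; last first.
  by rewrite -eqn0Ngt => /eqP ->; rewrite /= scale0r !mul0r mulr0 mul0r.
have [_ pX] := hX r (leqnn _); have [_ pZ] := hZ c (leq0n _).
apply: prop_mul pZ; apply: prop_mul pX _.
by apply: prop_mul sY.2; apply: prop_scale; apply: kappa_neq0.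
Qed.
End Elimination.

(** * Commutation relations in Uq *)

Section Relations.
Variables (K : fieldType) (n : nat) (s : n.+1.-tuple bool) (q : K).
Hypotheses (q0 : q != 0) (q_nroot : forall k : nat, (0 < k)%N -> q ^+ k != 1).
Local Notation I := 'I_n.+1.
Local Notation U := (Uq s q).
Local Notation t := (t s q).
Local Notation tbar := (tbar s q).
Local Notation parity := (parity s).
Local Notation q_ := (q_ s q).
Local Notation varsigma := (varsigma K s).

Lemma t_lt0 (i j : I) : (i < j)%N -> t i j = 0.
Proof. by case/(t_eq0 s q). Qed.

Lemma tbar_gt0 (i j : I) : (j < i)%N -> tbar i j = 0.
Proof. by case/(t_eq0 s q). Qed.

Lemma tt_rel (i j k l : I) :
  q_ i ^+ (i == k) *: (t i j * t k l)
    - (varsigma i j k l * q_ j ^+ (j == l)) *: (t k l * t i j) =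
  (varsigma i k k l * (q_ k - (q_ k)^-1) * ((j < l)%N%:R - (k < i)%N%:R))
       *: (t k j * t i l).
Proof. exact/Uq_rel/rtt_tt. Qed.

Lemma bb_rel (i j k l : I) :
  q_ i ^+ (i == k) *: (tbar i j * tbar k l)
    - (varsigma i j k l * q_ j ^+ (j == l)) *: (tbar k l * tbar i j) =
  (varsigma i k k l * (q_ k - (q_ k)^-1) * ((j < l)%N%:R - (k < i)%N%:R))
       *: (tbar k j * tbar i l).
Proof. exact/Uq_rel/rtt_bb. Qed.

Lemma tb_rel (i j k l : I) :
  q_ i ^+ (i == k) *: (t i j * tbar k l)
    - (varsigma i j k l * q_ j ^+ (j == l)) *: (tbar k l * t i j) =
  (varsigma i k k l * (q_ k - (q_ k)^-1))
       *: ((j < l)%N%:R *: (tbar k j * t i l)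
             - (k < i)%N%:R *: (t k j * tbar i l)).
Proof. exact/Uq_rel/rtt_tb. Qed.

Lemma varsigma_neq0 a b c e : varsigma a b c e != 0.
Proof. by rewrite /Defs.varsigma signr_eq0. Qed.

Lemma q_X_neq0 i (b : bool) : q_ i ^+ b != 0.
Proof. by rewrite expf_neq0 ?q_neq0. Qed.

Lemma qcomm_of_rel (a b : K) (x y : U) : a != 0 -> b != 0 ->
  a *: (x * y) - b *: (y * x) = 0 -> qcomm x y.
Proof.
move=> a0 b0 /eqP; rewrite subr_eq0 => /eqP e.
exists (a^-1 * b); first by rewrite mulf_neq0 ?invr_eq0.
by rewrite -scalerA -e scalerA mulVf // scale1r.
Qed.

(** The right-hand side of the relation is a multiple of t_ki t_il: wherever one of its two
    coefficients is nonzero, triangularity kills one of the factors. *)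
Lemma qcomm_tii_t i k l : qcomm (t i i) (t k l).
Proof.
apply: (@qcomm_of_rel (q_ i ^+ (i == k)) (varsigma i i k l * q_ i ^+ (i == l))).
- exact: q_X_neq0.
- by rewrite mulf_neq0 ?varsigma_neq0 ?q_X_neq0.
rewrite tt_rel; case: ltnP => [il|_]; first by rewrite (t_lt0 il) mulr0 scaler0.
case: ltnP => [ki|_]; first by rewrite (t_lt0 ki) mul0r scaler0.
by rewrite subrr mulr0 scale0r.
Qed.

Lemma qcomm_tii_tbar i k l : qcomm (t i i) (tbar k l).
Proof.
apply: (@qcomm_of_rel (q_ i ^+ (i == k)) (varsigma i i k l * q_ i ^+ (i == l))).
- exact: q_X_neq0.
- by rewrite mulf_neq0 ?varsigma_neq0 ?q_X_neq0.
rewrite tb_rel; case: ltnP => [il|_].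
  rewrite (t_lt0 il) mulr0 scaler0; case: ltnP => [ki|_]; last by rewrite scale0r subrr scaler0.
  by rewrite (t_lt0 ki) mul0r !scaler0 subrr scaler0.
case: ltnP => [ki|_]; last by rewrite !scale0r subrr scaler0.
by rewrite (t_lt0 ki) mul0r scaler0 scale0r subrr scaler0.
Qed.

Lemma qcomm_inv (x x' y : U) : x * x' = 1 -> x' * x = 1 -> qcomm x y -> qcomm x' y.
Proof.
move=> e e' [k k0 xy]; apply: prop_sym; exists k => //.
by rewrite -[y * x']mul1r -e' -mulrA (mulrA x) xy -scalerAl -scalerAr -mulrA e mulr1.
Qed.

Lemma qcomm_tbarii_t i k l : qcomm (tbar i i) (t k l).
Proof. exact: qcomm_inv (tK _ _ i) (tbarK _ _ i) (qcomm_tii_t i k l). Qed.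

Lemma qcomm_tbarii_tbar i k l : qcomm (tbar i i) (tbar k l).
Proof. exact: qcomm_inv (tK _ _ i) (tbarK _ _ i) (qcomm_tii_tbar i k l). Qed.

(** For two letters of one row the right-hand coefficient is proportional to delta_{j<l}; taking the
    pair in the other order makes it vanish. *)
Lemma qcomm_t_row i j l : qcomm (t i j) (t i l).
Proof.
wlog jl : j l / ~~ (j < l)%N => [hw|].
  case: (boolP (j < l)%N) => jl; last exact: hw.
  by apply/qcomm_sym/hw; rewrite -leqNgt ltnW.
apply: (@qcomm_of_rel (q_ i ^+ (i == i)) (varsigma i j i l * q_ j ^+ (j == l))).
- exact: q_X_neq0.
- by rewrite mulf_neq0 ?varsigma_neq0 ?q_X_neq0.
by rewrite tt_rel (negbTE jl) ltnn subrr mulr0 scale0r.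
Qed.

Lemma qcomm_tbar_col i j l : qcomm (tbar j i) (tbar l i).
Proof.
wlog jl : j l / ~~ (l < j)%N => [hw|].
  case: (boolP (l < j)%N) => jl; last exact: hw.
  by apply/qcomm_sym/hw; rewrite -leqNgt ltnW.
apply: (@qcomm_of_rel (q_ j ^+ (j == l)) (varsigma j i l i * q_ i ^+ (i == i))).
- exact: q_X_neq0.
- by rewrite mulf_neq0 ?varsigma_neq0 ?q_X_neq0.
by rewrite bb_rel (negbTE jl) ltnn subrr mulr0 scale0r.
Qed.

Lemma q_D_neq0 i j : parity i (+) parity j -> q_ i + q_ j != 0.
Proof.
move=> p; apply/eqP => e.
have e1 : q + q^-1 = 0.
  by move: p e; rewrite !q_E; case: (parity i); case: (parity j) => //= _ <-; rewrite // addrC.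
have e2 : q ^+ 2 = -1.
  apply/eqP; rewrite -addr_eq0; apply/eqP.
  by rewrite -(mulfV q0) expr2 -mulrDr e1 mulr0.
by have := q_nroot (isT : (0 < 4)%N); rewrite (exprM q 2 2) e2 sqrrN expr1n eqxx.
Qed.

(** The relation of an odd letter with itself reads (q_i + q_j) t_ij^2 = 0, and q_i + q_j is q +
    1/q, whose vanishing would give q^4 = 1. *)
Lemma t_odd_sq i j : parity i (+) parity j -> t i j * t i j = 0.
Proof.
move=> p; have := tt_rel i j i j.
rewrite !ltnn subrr mulr0 scale0r !eqxx !expr1 -scalerBl /Defs.varsigma p /= expr1 mulN1r opprK.
by move/eqP; rewrite scaler_eq0 (negbTE (q_D_neq0 p)) => /eqP.
Qed.

Lemma tbar_odd_sq i j : parity i (+) parity j -> tbar i j * tbar i j = 0.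
Proof.
move=> p; have := bb_rel i j i j.
rewrite !ltnn subrr mulr0 scale0r !eqxx !expr1 -scalerBl /Defs.varsigma p /= expr1 mulN1r opprK.
by move/eqP; rewrite scaler_eq0 (negbTE (q_D_neq0 p)) => /eqP.
Qed.

(** The exact scalar is recorded because it enters [kappa]; [tbar_mu] has the same one, so both
    halves are treated together. *)
Lemma t_mu (r c : I) : (c < r)%N -> t r r * t r c = (q_ r)^-1 *: (t r c * t r r).
Proof.
move=> cr; have := tt_rel r c r r.
rewrite cr ltnn eqxx -val_eqE /= (ltn_eqF cr) /Defs.varsigma addbb andbF /= !expr0 expr1 !mul1r subr0 mulr1.
move/eqP; rewrite scale1r subr_eq addrC -subr_eq => /eqP <-.
by rewrite -scalerBl opprB addrC subrK.
Qed.

Lemma tbar_mu (r c : I) : (c < r)%N ->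
  tbar r r * tbar c r = (q_ r)^-1 *: (tbar c r * tbar r r).
Proof.
move=> cr; have := bb_rel c r r r.
rewrite !ltnn eqxx -val_eqE /= (ltn_eqF cr) (ltnNge r c) (ltnW cr) /=.
rewrite /Defs.varsigma addbb andbF /= !expr0 expr1 !mul1r subrr mulr0 scale0r.
move/eqP; rewrite scale1r subr_eq0 => /eqP ->.
by rewrite scalerA mulVf ?q_neq0 // scale1r.
Qed.

Lemma t_straighten (i j k l : I) : (k < i)%N ->
  exists a b : K, t i j * t k l = a *: (t k l * t i j) + b *: (t k j * t i l).
Proof.
move=> ki; have := tt_rel i j k l; rewrite -val_eqE /= (gtn_eqF ki) expr0 scale1r.
by move/eqP; rewrite subr_eq addrC => /eqP ->; eexists; eexists.
Qed.

Lemma tbar_straighten (i j k l : I) : (k < i)%N ->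
  exists a b : K, tbar j i * tbar l k = a *: (tbar l k * tbar j i) + b *: (tbar j k * tbar l i).
Proof.
move=> ki; have := bb_rel l k j i; rewrite -[k == i]val_eqE /= (ltn_eqF ki) expr0 mulr1.
set a := q_ l ^+ _; set c := _ * (_ - _); set b := varsigma _ _ _ _.
move/eqP; rewrite subr_eq addrC -subr_eq => /eqP e.
exists (b^-1 * a), (- (b^-1 * c)).
rewrite -[LHS]scale1r -(mulVf (varsigma_neq0 l k j i)) -/b -scalerA -e.
by rewrite scalerBr !scalerA scaleNr.
Qed.

Lemma tbar_t_straighten (i j k l : I) :
  exists a b c : K, tbar k l * t i j = a *: (t i j * tbar k l)
    + (b * (j < l)%N%:R) *: (tbar k j * t i l) + (c * (k < i)%N%:R) *: (t k j * tbar i l).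
Proof.
have := tb_rel i j k l.
set a := q_ i ^+ _; set z := _ * (_ - _); set b := varsigma i j k l * _.
have b0 : b != 0 by rewrite mulf_neq0 ?varsigma_neq0 ?q_X_neq0.
move/eqP; rewrite subr_eq addrC -subr_eq => /eqP e.
exists (b^-1 * a), (- (b^-1 * z)), (b^-1 * z).
transitivity (b^-1 *: (b *: (tbar k l * t i j))); first by rewrite scalerA mulVf ?scale1r.
rewrite -e.
by rewrite !scalerBr opprB !scalerA mulNr scaleNr !mulrA addrA addrAC.
Qed.
End Relations.

(** * Linear independence *)

Section LinearIndependence.
Variables (K : fieldType) (V : lmodType K) (T : eqType) (X : T -> V).

Definition indep_on (P : T -> Prop) : Prop :=
  forall (r : seq T) (c : T -> K), uniq r -> (forall b, b \in r -> P b) ->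
    \sum_(b <- r) c b *: X b = 0 -> forall b, b \in r -> c b = 0.

Lemma indep_on_sub (P Q : T -> Prop) : (forall b, P b -> Q b) -> indep_on Q -> indep_on P.
Proof. by move=> PQ iQ r c ur rP; apply: iQ => // b /rP/PQ. Qed.

(** Induction on a bound for h: [g] kills the vectors with h = 0 and sends the others to multiples
    of vectors with smaller h, still distinct because [sh] is injective. So their coefficients
    vanish, and what remains is a relation with h = 0. *)
Lemma indep_lower (P : T -> Prop) (h : T -> nat) (sh sh' : T -> T) (g : V -> V) :
  g 0 = 0 -> (forall x y, g (x + y) = g x + g y) -> (forall c x, g (c *: x) = c *: g x) ->
  cancel sh sh' ->
  (forall b, P b -> (0 < h b)%N -> exists2 k : K, k != 0 & g (X b) = k *: X (sh b)) ->
  (forall b, P b -> h b = 0%N -> g (X b) = 0) ->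
  (forall b, P b -> (0 < h b)%N -> P (sh b) /\ (h (sh b) < h b)%N) ->
  indep_on (fun b => P b /\ h b = 0%N) -> indep_on P.
Proof.
move=> g0 gD gZ shK gX gX0 Psh indep0.
suff H m : indep_on (fun b => P b /\ (h b <= m)%N).
  move=> r c ur rP; apply: (H (\max_(b <- r) h b)) => // b br; split; first exact: rP.
  exact: leq_bigmax_seq.
elim: m => [|m IHm]; first by apply: indep_on_sub indep0 => b [Pb]; rewrite leqn0 => /eqP.
move=> r c ur rP rel.
have /choice[k kP] : forall b, exists k : K, P b -> (0 < h b)%N -> k != 0 /\ g (X b) = k *: X (sh b).
  move=> b; case: (pselect (P b)) => [Pb|]; last by exists 0.
  have [hb|hb] := posnP (h b); first by exists 0.
  by have [k k0 e] := gX b Pb hb; exists k.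
pose r1 := [seq b <- r | (0 < h b)%N].
have r1P b : b \in r1 -> [/\ b \in r, P b & (0 < h b)%N].
  by rewrite mem_filter => /andP[hb br]; split=> //; case: (rP b br).
have rel1 : \sum_(b <- map sh r1) (c (sh' b) * k (sh' b)) *: X b = 0.
  rewrite big_map; transitivity (g (\sum_(b <- r) c b *: X b)); last by rewrite rel.
  have gsum (s : seq T) : g (\sum_(b <- s) c b *: X b) = \sum_(b <- s) c b *: g (X b).
    by elim: s => [|b s IHs]; rewrite ?big_nil // !big_cons gD gZ IHs.
  rewrite gsum [RHS](bigID (fun b => (0 < h b)%N)) /= [X in _ = _ + X]big_seq_cond.
  rewrite [X in _ = _ + X]big1 ?addr0 => [|b /andP[br]]; last first.
    by rewrite lt0n negbK => /eqP hb; rewrite gX0 ?scaler0 //; case: (rP b br).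
  transitivity (\sum_(b <- r1) c b *: g (X b)); last by rewrite big_filter.
  rewrite big_seq [RHS]big_seq; apply: eq_bigr => b br1.
  have [_ Pb hb] := r1P b br1; have [_ ->] := kP b Pb hb.
  by rewrite shK scalerA.
have c0 b : b \in r -> (0 < h b)%N -> c b = 0.
  move=> br hb; have br1 : b \in r1 by rewrite mem_filter hb.
  have [_ Pb _] := r1P b br1; have [k0 _] := kP b Pb hb.
  have : c (sh' (sh b)) * k (sh' (sh b)) = 0.
    apply: (IHm (map sh r1) (fun b => c (sh' b) * k (sh' b))); rewrite ?map_f //.
      by rewrite map_inj_uniq ?filter_uniq //; apply: can_inj shK.
    move=> _ /mapP[b' b'r1 ->]; have [b'r Pb' hb'] := r1P b' b'r1.
    have [Psb' lt_h] := Psh b' Pb' hb'; split=> //; have [_ hm] := rP b' b'r.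
    by rewrite -ltnS (leq_trans lt_h).
  by move/eqP; rewrite shK mulf_eq0 (negbTE k0) orbF => /eqP.
move=> b br; have [hb|hb] := posnP (h b); last exact: c0.
apply: (indep0 [seq b <- r | h b == 0%N]) => [|b'||]; first exact: filter_uniq.
- by rewrite mem_filter => /andP[/eqP hb' b'r]; split=> //; case: (rP b' b'r).
- transitivity (\sum_(b <- r) c b *: X b) => //; rewrite big_filter.
  rewrite [RHS](bigID (fun b => h b == 0%N)) /= [X in _ = _ + X]big_seq_cond.
  by rewrite [X in _ = _ + X]big1 ?addr0 // => b' /andP[b'r hb']; rewrite c0 ?scale0r ?lt0n.
- by rewrite mem_filter hb eqxx.
Qed.

Lemma indep_eigen (J : finType) (P : T -> Prop) (psi : J -> V -> V) (lam : J -> T -> K) :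
  (forall j, psi j 0 = 0) -> (forall j x y, psi j (x + y) = psi j x + psi j y) ->
  (forall j c x, psi j (c *: x) = c *: psi j x) ->
  (forall j b, P b -> psi j (X b) = lam j b *: X b) ->
  (forall b, P b -> X b != 0) ->
  (forall b b', P b -> P b' -> (forall j, lam j b = lam j b') -> b = b') ->
  indep_on P.
Proof.
move=> p0 pD pZ pX X0 sep r.
have psum j c (s : seq T) : psi j (\sum_(b <- s) c b *: X b) = \sum_(b <- s) c b *: psi j (X b).
  by elim: s => [|b s IHs]; rewrite ?big_nil // !big_cons pD pZ IHs.
elim: r => // b0 r IHr c /= /andP[b0r ur] rP rel.
have Pb0 : P b0 by apply: rP; rewrite mem_head.
have rP' b : b \in r -> P b by move=> br; apply: rP; rewrite inE br orbT.
have cr b : b \in r -> c b = 0.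
  move=> br; have [j lj] : exists j, lam j b != lam j b0.
    apply: contrapT => h; have e : b = b0; last by rewrite e (negbTE b0r) in br.
    apply: sep => //; first exact: rP'.
    by move=> j; apply/eqP/negPn/negP => hj; apply: h; exists j.
  (* These coefficients come from applying psi_j - lam_j(b0), which removes b0 and leaves a shorter
     relation. *)
  have : (lam j b - lam j b0) * c b = 0.
    apply: (IHr (fun b => (lam j b - lam j b0) * c b)) => //.
    transitivity (psi j (\sum_(b <- b0 :: r) c b *: X b) - lam j b0 *: \sum_(b <- b0 :: r) c b *: X b).
      rewrite psum scaler_sumr -sumrB big_cons pX // scalerA mulrC -scalerA subrr add0r.
      rewrite [LHS]big_seq [RHS]big_seq; apply: eq_bigr => b1 b1r.
      rewrite (pX _ _ (rP' _ b1r)) !scalerA -scalerBl; congr (_ *: _); ring.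
    by rewrite rel p0 scaler0 subrr.
  by move/eqP; rewrite mulf_eq0 subr_eq0 (negbTE lj) => /eqP.
move=> b; rewrite inE => /predU1P[->|]; last exact: cr.
move: rel; rewrite big_cons big_seq big1 ?addr0 => [/eqP|b1 /cr ->]; last by rewrite scale0r.
by rewrite scaler_eq0 (negbTE (X0 _ Pb0)) orbF => /eqP.
Qed.
End LinearIndependence.

(* The entries below the diagonal are cleared from the last row upwards, and from
   left to right within a row. *)
Lemma indep_chain (K : fieldType) (V : lmodType K) (n : nat) (T : eqType) (X : T -> V)
    (ent : T -> 'I_n -> 'I_n -> nat) (Q : T -> Prop) :
  (forall r c : 'I_n, (c < r)%N ->
     let P b := [/\ Q b, (forall i j : 'I_n, (j < i)%N -> (r < i)%N -> ent b i j = 0%N)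
                 & (forall j : 'I_n, (j < c)%N -> ent b r j = 0%N)] in
     indep_on X (fun b => P b /\ ent b r c = 0%N) -> indep_on X P) ->
  indep_on X (fun b => Q b /\ forall i j : 'I_n, (j < i)%N -> ent b i j = 0%N) ->
  indep_on X Q.
Proof.
move=> step base.
(* Rows from [k] on are cleared: k = 0 is the hypothesis [base] and k = n is the goal. *)
suff H k : (k <= n)%N -> indep_on X (fun b => Q b /\
    forall i j : 'I_n, (j < i)%N -> (k <= i)%N -> ent b i j = 0%N).
  by apply: indep_on_sub (H n (leqnn n)) => b Qb; split=> // i j _; rewrite leqNgt ltn_ord.
elim: k => [|k IHk] kn.
  by apply: indep_on_sub base => b [Qb h]; split=> // i j ji; apply: h.
pose r := Ordinal kn.
(* In row [k] the columns below [k - m] are cleared: m = 0 follows from the claim for [k], and m = k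
   gives the claim for [k.+1]. *)
suff H m : (m <= k)%N -> indep_on X (fun b => [/\ Q b,
    (forall i j : 'I_n, (j < i)%N -> (r < i)%N -> ent b i j = 0%N)
    & (forall j : 'I_n, (j < k - m)%N -> ent b r j = 0%N)]).
  apply: indep_on_sub (H k (leqnn k)) => b [Qb h]; split=> //.
  by move=> j; rewrite subnn.
elim: m => [|m IHm] mk.
  apply: indep_on_sub (IHk (ltnW kn)) => b [Qb h h']; split=> // i j ji.
  rewrite leq_eqVlt => /predU1P[e|ki]; last exact: h.
  have ir : i = r by apply: val_inj.
  by rewrite ir; apply: h'; rewrite subn0 e.
have ck : (k - m.+1 < n)%N by lia.
apply: (step r (Ordinal ck)) => /=; first by lia.
apply: indep_on_sub (IHm (ltnW mk)) => b [[Qb h h'] h0]; split=> // j jm.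
have [jlt|jge] := ltnP j (k - m.+1); first exact: h'.
have -> // : j = Ordinal ck by apply: val_inj => /=; lia.
Qed.

Lemma enum_ord_split n (r : 'I_n) : exists s1 s2, [/\ enum 'I_n = s1 ++ r :: s2,
  {in s1, forall i : 'I_n, (i < r)%N} & {in s2, forall i : 'I_n, (r < i)%N}].
Proof.
have sz : (r < size (enum 'I_n))%N by rewrite size_enum_ord.
exists (take r (enum 'I_n)), (drop r.+1 (enum 'I_n)); split.
- rewrite -[LHS](cat_take_drop r); congr (_ ++ _).
  by rewrite (drop_nth r) // nth_ord_enum.
- move=> i /(nthP r)[k]; rewrite size_take sz => kr <-.
  by rewrite nth_take // nth_enum_ord // (ltn_trans kr).
- move=> i /(nthP r)[k]; rewrite size_drop size_enum_ord => kr <-.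
  by rewrite nth_drop nth_enum_ord; lia.
Qed.

Lemma big_ord_enum (A : pzRingType) n (P : pred 'I_n) (F : 'I_n -> A) :
  \prod_(i < n | P i) F i = \prod_(i <- enum 'I_n | P i) F i.
Proof. by rewrite enumT. Qed.

(** * Independence of the ordered monomials *)

Section Independence.
Variables (K : fieldType) (n : nat) (s : n.+1.-tuple bool) (q : K).
Hypotheses (q0 : q != 0) (q_nroot : forall k : nat, (0 < k)%N -> q ^+ k != 1).
Local Notation I := 'I_n.+1.
Local Notation U := (Uq s q).
Local Notation t := (t s q).
Local Notation tbar := (tbar s q).
Local Notation parity := (parity s).
Local Notation q_ := (q_ s q).
Local Notation sgn := (koszul K s).
Local Notation tde := (tbar_diag_exp s q).
Local Notation M := 'M[int]_n.+1.
Local Notation X := (pbw_monomial s q).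

Definition lower_row (b : M) (i : I) : U :=
  \prod_(j <- rev (enum 'I_n.+1) | (j < i)%N) t i j ^+ `|b i j|%N.
Definition upper_col (b : M) (i : I) : U :=
  \prod_(j < n.+1 | (j < i)%N) tbar j i ^+ `|b j i|%N.
Definition diag_part (b : M) : U := \prod_(i < n.+1) tde i (b i i).

Lemma pbwE b : X b = \prod_(i < n.+1) lower_row b i * diag_part b * \prod_(i < n.+1) upper_col b i.
Proof. by []. Qed.

Lemma nu_neq0 : nu q != 0.
Proof.
apply/eqP; rewrite /nu => /eqP; rewrite subr_eq0 => /eqP e.
by have := q_nroot (isT : (0 < 2)%N); rewrite expr2 {1}e mulVf ?eqxx.
Qed.

Lemma prop_entry (A : algType K) (f : {lrmorphism U -> alg_mx A n}) x y a b :
  prop_to x y -> prop_to (f x a b) (f y a b).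
Proof. by move=> [k k0 ->]; exists k; rewrite // linearZ alg_mxZE. Qed.

Lemma tdeS_t i (z : int) : tde i (z - 1) = t i i * tde i z.
Proof.
case: z => [[|k]|k].
- by rewrite sub0r /= expr0 mulr1.
- rewrite -[k.+1]addn1 PoszD addrK /= addn1 exprS mulrA tK //.
  by rewrite mul1r.
- have -> : Negz k - 1 = Negz k.+1 by lia.
  by rewrite /= exprS.
Qed.

Lemma tdeS_tbar i (z : int) : tde i (z + 1) = tbar i i * tde i z.
Proof.
by rewrite -[z in RHS](addrK 1) tdeS_t mulrA tbarK // mul1r.
Qed.

Lemma qcomm_tde y i z : (qcomm y (t i i)) -> (qcomm y (tbar i i)) -> qcomm y (tde i z).
Proof. by move=> h h'; case: z => k; apply: qcommX. Qed.

Lemma qcomm_t_tde r i z : qcomm (t r r) (tde i z).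
Proof. by apply: qcomm_tde; [apply: qcomm_tii_t|apply: qcomm_tii_tbar]. Qed.

Lemma qcomm_tbar_tde r i z : qcomm (tbar r r) (tde i z).
Proof. by apply: qcomm_tde; [apply: qcomm_tbarii_t|apply: qcomm_tbarii_tbar]. Qed.

(** The letter y commutes up to scalars with the diagonal factors before position r, so it can be
    absorbed there. *)
Lemma diag_part_shift (b b' : M) (r : I) (y : U) :
  (forall i z, qcomm y (tde i z)) -> tde r (b' r r) = y * tde r (b r r) ->
  (forall i, i != r -> b' i i = b i i) ->
  prop_to (diag_part b') (y * diag_part b).
Proof.
move=> yq e e'; rewrite /diag_part !big_ord_enum.
have [s1 [s2 [-> h1 h2]]] := enum_ord_split r.
have nr i : (i \in s1) || (i \in s2) -> b' i i = b i i.
  by case/orP => [/h1|/h2] ir; apply: e'; rewrite -val_eqE /= ?(ltn_eqF ir) ?(gtn_eqF ir).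
rewrite !big_cat !big_cons /= e.
rewrite (eq_big_seq (fun i => tde i (b i i))) => [|i i1]; last by rewrite nr ?i1.
rewrite (eq_big_seq (F1 := fun i => tde i (b' i i)) (fun i => tde i (b i i))); last first.
  by move=> i i2; rewrite nr ?i2 ?orbT.
rewrite !mulrA; do 2!apply: prop_mul (prop_refl _).
by apply: prop_sym; apply: qcomm_prod.
Qed.

Section Exponents.
Variables (b : M).
Hypothesis pbw_b : pbw_exponents s b.
Lemma pbw_ge0 i j : i != j -> 0 <= b i j.
Proof. by move=> ij; have := forallP (forallP pbw_b i) j; rewrite ij /= => /andP[]. Qed.

Lemma pbw_odd i j : i != j -> parity i (+) parity j ==> (`|b i j| <= 1)%N.
Proof.
move=> ij; have := forallP (forallP pbw_b i) j; rewrite ij /= => /andP[b0 h].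
by apply/implyP => p; move: b0 h; rewrite p /=; lia.
Qed.
End Exponents.

Lemma pbw_update (b b' : M) (r c : I) : pbw_exponents s b ->
  (forall i j, i != j -> (i, j) != (r, c) -> b' i j = b i j) ->
  (0 < `|b r c|)%N -> r != c -> b' r c = b r c - 1 -> pbw_exponents s b'.
Proof.
move=> pb eb b0 rc e; apply/forallP => i; apply/forallP => j; apply/implyP => ij.
have := forallP (forallP pb i) j; rewrite ij /= => /andP[bij h].
have [[ei ej]|ne] := eqVneq (i, j) (r, c); last by rewrite eb // bij.
rewrite ei ej in bij h *; rewrite e; apply/andP; split; first by lia.
by apply/implyP => p; move: h; rewrite p /=; lia.
Qed.

Lemma prod_eq1 (J : eqType) (l : seq J) (P : pred J) (F : J -> U) :
  (forall j, j \in l -> P j -> F j = 1) -> \prod_(j <- l | P j) F j = 1.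
Proof. by move=> h; rewrite big_seq_cond big1 // => j /andP[]; apply: h. Qed.

Lemma tri_diag_letter (f : {lrmorphism U -> alg_mx U n}) (y : U) r :
  (forall a b : I, (b < a)%N -> f y a b = 0) -> (forall a, prop_to (f y a a) y) -> tri f r y.
Proof. by move=> h h' e re; split=> // d; apply: h. Qed.

Lemma tri_tde (f : {lrmorphism U -> alg_mx U n}) r i z :
  tri f r (t i i) -> tri f r (tbar i i) -> tri f r (tde i z).
Proof. by move=> h h'; case: z => k; apply: triX. Qed.

Lemma absz_subr1 (x : int) : 0 <= x -> (0 < `|x|)%N -> `|x - 1|%N = `|x|%N.-1.
Proof. by lia. Qed.

(** * Elimination of the t's *)

Section LowerStep.
Variables (r c : I).
Hypothesis cr : (c < r)%N.
(* The entry (r, c) of [hom_r] removes a letter t_rc and puts t_rr in its place,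
   which lowers the exponent of \bar t_rr. *)
Definition lower_shift (b : M) : M := b - delta_mx r c - delta_mx r r.
Definition lower_shift_inv (b : M) : M := b + delta_mx r r + delta_mx r c.
Lemma lower_shiftK : cancel lower_shift lower_shift_inv.
Proof. by move=> b; rewrite /lower_shift /lower_shift_inv subrK subrK. Qed.

Lemma lower_shiftE (b : M) (i j : I) :
  lower_shift b i j = b i j - ((i == r) && (j == c))%:Z - ((i == r) && (j == r))%:Z.
Proof. by rewrite !mxE !pmulrn; case: (_ && _) (_ && _) => [] []. Qed.

Lemma lower_shift_rc b : lower_shift b r c = b r c - 1.
Proof.
by rewrite lower_shiftE !eqxx /= -[c == r]val_eqE /= (ltn_eqF cr) subr0.
Qed.

Lemma lower_shift_rr b : lower_shift b r r = b r r - 1.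
Proof.
by rewrite lower_shiftE !eqxx /= -[r == c]val_eqE /= (gtn_eqF cr) subr0.
Qed.

Lemma lower_shift_other (b : M) (i j : I) :
  (i, j) != (r, c) -> (i, j) != (r, r) -> lower_shift b i j = b i j.
Proof.
by rewrite lower_shiftE !xpair_eqE => /negbTE -> /negbTE ->; rewrite !subr0.
Qed.

Definition lower_cond (b : M) : Prop :=
  [/\ pbw_exponents s b,
      (forall i j : I, (j < i)%N -> (r < i)%N -> `|b i j|%N = 0%N)
    & (forall j : I, (j < c)%N -> `|b r j|%N = 0%N)].

Definition lower_left (b : M) (l : seq I) : U := \prod_(i <- l) lower_row b i.
Definition lower_mid (b : M) (l : seq I) : U :=
  \prod_(j <- rev l | (j < r)%N) t r j ^+ `|b r j|%N.

Lemma lower_factor s1 s2 u1 u2 (b : M) :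
  enum 'I_n.+1 = s1 ++ r :: s2 -> {in s2, forall i : I, (r < i)%N} ->
  enum 'I_n.+1 = u1 ++ c :: u2 -> {in u1, forall i : I, (i < c)%N} ->
  (forall i j : I, (j < i)%N -> (r < i)%N -> `|b i j|%N = 0%N) ->
  (forall j : I, (j < c)%N -> `|b r j|%N = 0%N) ->
  \prod_(i < n.+1) lower_row b i = lower_left b s1 * (lower_mid b u2 * t r c ^+ `|b r c|%N).
Proof.
move=> es hs2 eu hu1 b1 b2; rewrite big_ord_enum es big_cat big_cons /=.
rewrite (prod_eq1 (l := s2)) ?mulr1 => [|i i2 _]; last first.
  by apply: big1 => j ji; rewrite b1 ?hs2 // expr0.
congr (_ * _); rewrite /lower_row eu rev_cat rev_cons -cats1 !big_cat big_cons big_nil /= cr mulr1.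
by rewrite (prod_eq1 (l := rev u1)) ?mulr1 // => j; rewrite mem_rev => /hu1 jc _; rewrite b2.
Qed.

(** In the notation of [entry_row], X consists of the rows before r, Y of the letters t_rj with j >
    c, and Z of the diagonal part and the \bar t's, which never step down under this
    homomorphism. *)
Lemma lower_step (b : M) (f : {lrmorphism U -> alg_mx U n}) :
  (forall i j a b,
  f (t i j) a b = (if a == b then (sgn i a * rdiagV s q j a) *: t i j
    else if (b == j) && (b < a)%N then (sgn_r K s i a j a * - nu q) *: t i a else 0) /\
  f (tbar i j) a b = (if a == b then (sgn i a * rdiag s q j a) *: tbar i j
    else if (b == j) && (a < b)%N then (sgn_r K s i a j a * nu q) *: tbar i a else 0)) ->
  lower_cond b ->
  if (0 < `|b r c|)%N then prop_to (f (X b) r c) (X (lower_shift b)) else f (X b) r c = 0.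
Proof.
move=> fE [pb b1 b2].
have rc : r != c by rewrite -val_eqE /= gtn_eqF.
have [s1 [s2 [es hs1 hs2]]] := enum_ord_split r.
have [u1 [u2 [eu hu1 hu2]]] := enum_ord_split c.
set m := `|b r c|%N; set L := lower_left b s1; set Y := lower_mid b u2.
set Z := diag_part b * \prod_(i < n.+1) upper_col b i.
have xc (j : I) k : qcomm (t r j) (t r c ^+ k) by apply/qcommX/qcomm_t_row.
(* Columns decrease along a row of t's, so t_rc stands last among the remaining letters, whereas
   [entry_row] wants it first. *)
have Yc k : prop_to (Y * t r c ^+ k) (t r c ^+ k * Y).
  by apply/prop_sym; apply: qcomm_prod => j _; apply/qcommX/qcomm_sym/xc.
have XbE : prop_to (X b) (L * (t r c ^+ m * Y) * Z).
  rewrite pbwE (lower_factor es hs2 eu hu1 b1 b2) -mulrA.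
  by apply: prop_mul (prop_refl _); apply: prop_mul (prop_refl _) _; apply: Yc.
pose o (i a j : I) := sgn_r K s i a j a * - nu q.
have x_off (i j a a' : I) : a != a' -> f (t i j) a a' =
    if (a' == j) && (a' < a)%N then o i a j *: t i a else 0.
  by move=> aa; have [-> _] := fE i j a a'; rewrite (negbTE aa).
have x_tri (i j : I) (ij : (i < j)%N) := t_lt0 s q ij.
have x_diag i j a : f (t i j) a a = (sgn i a * rdiagV s q j a) *: t i j.
  by have [-> _] := fE i j a a; rewrite eqxx.
have o_neq0 (i j a : I) : o i a j != 0.
  by rewrite mulf_neq0 ?signr_eq0 // oppr_eq0 nu_neq0.
have tri_t i : tri f 0 (t i i).
  apply: tri_diag_letter => [a a' lt_a|a]; last first.
    by rewrite x_diag; apply: prop_scale; rewrite mulf_neq0 ?koszul_neq0 ?rdiagV_neq0.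
  rewrite x_off; last by rewrite -val_eqE /= gtn_eqF.
  by case: eqP => [ai|//]; rewrite /= lt_a -ai (t_lt0 _ _ lt_a) scaler0.
have tri_tb i j : tri f 0 (tbar i j).
  apply: tri_diag_letter => [a a' lt_a|a].
    have [_ ->] := fE i j a a'; rewrite -val_eqE /= (gtn_eqF lt_a) (ltnNge a) (ltnW lt_a) andbF //.
  have [_ ->] := fE i j a a; rewrite eqxx; apply: prop_scale.
  by rewrite mulf_neq0 ?koszul_neq0 // /rdiag mulf_neq0 ?koszul_neq0 // q_X_neq0.
have triZ : tri f 0 Z.
  apply: triM; first by apply: tri_prod => i _; apply: tri_tde.
  by apply: tri_prod => i _; apply: tri_prod => j _; apply: triX.
have triL : tri f r L.
  rewrite /L /lower_left big_seq; apply: tri_prod => i /hs1 ir.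
  apply: tri_prod => j _; apply: triX; exact: (tri_x q0 x_tri x_off x_diag).
have YE : Y = \prod_(j <- rev u2 | (j \in rev u2) && (j < r)%N) t r j ^+ `|b r j|%N.
  by rewrite /Y /lower_mid big_seq_cond.
have wY : window f r c Y.
  rewrite YE; apply: window_prod => j /andP[]; rewrite mem_rev => /hu2 /ltnW cj _.
  apply: windowX; exact: (window_x x_tri x_off).
have sY : stable_col f c Y.
  rewrite YE; apply: stable_col_prod => j /andP[]; rewrite mem_rev => /hu2 cj _.
  apply: stable_colX; apply: (stable_col_x q0 x_off x_diag).
  by rewrite -val_eqE /= gtn_eqF.
have := entry_row q0 q_nroot x_tri o_neq0 x_off x_diag (t_mu s q) cr triL wY sY triZ (pbw_odd pb rc).
have := prop_entry f r c XbE.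
rewrite -/m; case: ifP => [m0 h1 h2|_ [k k0 ->] ->]; last by rewrite scaler0.
apply: (prop_trans h1); apply: (prop_trans h2).
have shE (i j : I) : (j < i)%N -> (i, j) != (r, c) -> lower_shift b i j = b i j.
  move=> ji ne; apply: lower_shift_other => //; rewrite xpair_eqE.
  by apply/negP => /andP[/eqP ir /eqP jr]; rewrite ir jr ltnn in ji.
have D' : prop_to (diag_part (lower_shift b)) (t r r * diag_part b).
  apply: (@diag_part_shift _ _ r); first exact: qcomm_t_tde.
    by rewrite lower_shift_rr tdeS_t.
  move=> i ir; apply: lower_shift_other; rewrite xpair_eqE (negbTE ir) //.
have L' : lower_left (lower_shift b) s1 = L.
  apply: eq_big_seq => i /hs1 ir; apply: eq_bigr => j ji; rewrite shE // xpair_eqE.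
  by rewrite -val_eqE /= (ltn_eqF ir).
have Y' : lower_mid (lower_shift b) u2 = Y.
  rewrite YE /lower_mid big_seq_cond; apply: eq_bigr => j /andP[]; rewrite mem_rev => /hu2 cj jr.
  by rewrite shE // xpair_eqE eqxx -val_eqE /= (gtn_eqF cj).
have U' : \prod_(i < n.+1) upper_col (lower_shift b) i = \prod_(i < n.+1) upper_col b i.
  apply: eq_bigr => i _; apply: eq_bigr => j ji; congr (_ ^+ `|_|%N).
  apply: lower_shift_other; rewrite xpair_eqE; apply/negP => /andP[/eqP e1 /eqP e2].
    by move: ji; rewrite e1 e2 ltnNge ltnW.
  by move: ji; rewrite e1 e2 ltnn.
have m' : `|lower_shift b r c|%N = m.-1.
  by rewrite lower_shift_rc; exact: absz_subr1 (pbw_ge0 pb rc) m0.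
rewrite pbwE (@lower_factor s1 s2 u1 u2) // ?L' ?Y' ?U' ?m'; last first.
- move=> j jc; rewrite shE ?b2 ?(ltn_trans jc cr) // xpair_eqE eqxx -val_eqE /= (ltn_eqF jc) //.
- move=> i j ji ri; rewrite shE ?b1 // xpair_eqE -val_eqE /= (gtn_eqF ri) //.
apply: prop_sym; rewrite /Z (mulrA _ (diag_part b)) -!(mulrA L).
apply: prop_mul (prop_refl _) _; apply: prop_mul _ (prop_refl _).
apply: (@prop_trans _ _ (t r c ^+ m.-1 * Y * (t r r * diag_part b))).
  by apply: prop_mul _ D'; apply: Yc.
rewrite mulrA; apply: prop_mul _ (prop_refl _); rewrite -!mulrA; apply: prop_mul (prop_refl _) _.
by apply/prop_sym; apply: qcomm_prod => j _; apply/qcommX/qcomm_tii_t.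
Qed.

Lemma lower_indep :
  indep_on X (fun b => lower_cond b /\ `|b r c|%N = 0%N) -> indep_on X lower_cond.
Proof.
have [f fE] := hom_r s q0.
have rc : r != c by rewrite -val_eqE /= gtn_eqF.
apply: (indep_lower (h := fun b : M => `|b r c|%N) (sh := lower_shift) (g := fun x => f x r c)).
- by rewrite linear0 mxE.
- by move=> x y; rewrite raddfD alg_mxDE.
- by move=> k x; rewrite linearZ alg_mxZE.
- exact: lower_shiftK.
- by move=> b Pb hb; have := lower_step fE Pb; rewrite hb.
- by move=> b Pb hb; have := lower_step fE Pb; rewrite hb.
move=> b [pb b1 b2] /= hb; have m' : `|lower_shift b r c|%N = `|b r c|%N.-1.
  by rewrite lower_shift_rc; exact: absz_subr1 (pbw_ge0 pb rc) hb.
split; last by rewrite m' ltn_predL.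
have shE (i j : I) : i != j -> (i, j) != (r, c) -> lower_shift b i j = b i j.
  move=> ij ne; apply: lower_shift_other => //; rewrite xpair_eqE.
  by apply/negP => /andP[/eqP ir /eqP jr]; rewrite ir jr eqxx in ij.
split.
- by apply: (pbw_update pb shE); rewrite ?lower_shift_rc.
- move=> i j ji ri; rewrite shE ?b1 // ?xpair_eqE -?val_eqE /= ?(gtn_eqF ri) ?(gtn_eqF ji) //.
- move=> j jc; rewrite shE ?b2 // ?xpair_eqE -?val_eqE /= ?eqxx ?(ltn_eqF jc) //.
  by rewrite gtn_eqF // (ltn_trans jc).
Qed.
End LowerStep.

(** * Elimination of the \bar t's *)

Section UpperStep.
Variables (r c : I).
Hypothesis cr : (c < r)%N.
(** The removed \bar t_cr is replaced by \bar t_rr, so here the diagonal exponent goes up. *)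
Definition upper_shift (b : M) : M := b - delta_mx c r + delta_mx r r.
Definition upper_shift_inv (b : M) : M := b - delta_mx r r + delta_mx c r.
Lemma upper_shiftK : cancel upper_shift upper_shift_inv.
Proof. by move=> b; rewrite /upper_shift /upper_shift_inv addrK subrK. Qed.

Lemma upper_shiftE (b : M) (i j : I) :
  upper_shift b i j = b i j - ((i == c) && (j == r))%:Z + ((i == r) && (j == r))%:Z.
Proof. by rewrite !mxE !pmulrn; case: (_ && _) (_ && _) => [] []. Qed.

Lemma upper_shift_cr b : upper_shift b c r = b c r - 1.
Proof. by rewrite upper_shiftE !eqxx -[c == r]val_eqE /= (ltn_eqF cr) addr0. Qed.

Lemma upper_shift_rr b : upper_shift b r r = b r r + 1.
Proof. by rewrite upper_shiftE !eqxx -[r == c]val_eqE /= (gtn_eqF cr) subr0. Qed.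

Lemma upper_shift_other (b : M) (i j : I) :
  (i, j) != (c, r) -> (i, j) != (r, r) -> upper_shift b i j = b i j.
Proof.
by rewrite upper_shiftE !xpair_eqE => /negbTE -> /negbTE ->; rewrite subr0 addr0.
Qed.

Lemma upper_shift_neq (b : M) (i j : I) :
  i != j -> (i, j) != (c, r) -> upper_shift b i j = b i j.
Proof.
move=> ij ne; apply: upper_shift_other => //; rewrite xpair_eqE.
by apply/negP => /andP[/eqP ir /eqP jr]; rewrite ir jr eqxx in ij.
Qed.

Definition upper_cond (b : M) : Prop :=
  [/\ pbw_exponents s b /\ (forall i j : I, (j < i)%N -> `|b i j|%N = 0%N),
      (forall i j : I, (j < i)%N -> (r < i)%N -> `|b j i|%N = 0%N)
    & (forall j : I, (j < c)%N -> `|b j r|%N = 0%N)].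

Definition upper_left (b : M) (l : seq I) : U := \prod_(i <- l) upper_col b i.
Definition upper_mid (b : M) (l : seq I) : U :=
  \prod_(j <- l | (j < r)%N) tbar j r ^+ `|b j r|%N.

Lemma upper_factor s1 s2 u1 u2 (b : M) :
  enum 'I_n.+1 = s1 ++ r :: s2 -> {in s2, forall i : I, (r < i)%N} ->
  enum 'I_n.+1 = u1 ++ c :: u2 -> {in u1, forall i : I, (i < c)%N} ->
  (forall i j : I, (j < i)%N -> (r < i)%N -> `|b j i|%N = 0%N) ->
  (forall j : I, (j < c)%N -> `|b j r|%N = 0%N) ->
  \prod_(i < n.+1) upper_col b i = upper_left b s1 * (tbar c r ^+ `|b c r|%N * upper_mid b u2).
Proof.
move=> es hs2 eu hu1 b1 b2; rewrite big_ord_enum es big_cat big_cons /=.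
rewrite (prod_eq1 (l := s2)) ?mulr1 => [|i i2 _]; last first.
  by apply: big1 => j ji; rewrite b1 ?hs2 // expr0.
congr (_ * _); rewrite /upper_col big_ord_enum eu big_cat big_cons /= cr.
by rewrite (prod_eq1 (l := u1)) ?mul1r // => j /hu1 jc _; rewrite b2.
Qed.

Lemma upper_step (b : M) (f : {lrmorphism U -> alg_mx U n}) :
  (forall i j a b,
  f (t i j) a b = (if a == b then (sgn j a * rdiag s q i a) *: t i j
    else if (b == i) && (a < b)%N then (sgn j a * nu q) *: t a j else 0) /\
  f (tbar i j) a b = (if a == b then (sgn j a * rdiagV s q i a) *: tbar i j
    else if (b == i) && (b < a)%N then (sgn j a * - nu q) *: tbar a j else 0)) ->
  upper_cond b ->
  if (0 < `|b c r|)%N then prop_to (f (X b) r c) (X (upper_shift b)) else f (X b) r c = 0.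
Proof.
move=> fE [[pb _] b1 b2].
have rc : c != r by rewrite -val_eqE /= ltn_eqF.
have [s1 [s2 [es hs1 hs2]]] := enum_ord_split r.
have [u1 [u2 [eu hu1 hu2]]] := enum_ord_split c.
set m := `|b c r|%N; set C := upper_left b s1; set Y := upper_mid b u2.
set L := \prod_(i < n.+1) lower_row b i.
pose x (i j : I) := tbar j i.
(* Column r is the last nontrivial one and \bar t_cr its first remaining letter: everything else
   precedes, and the factor Z of [entry_row] is 1. *)
have XbE : X b = L * diag_part b * C * (x r c ^+ m * Y) * 1.
  by rewrite pbwE (upper_factor es hs2 eu hu1 b1 b2) mulr1 !mulrA.
pose o (i a j : I) := sgn i a * - nu q.
have x_off (i j a a' : I) : a != a' -> f (x i j) a a' =
    if (a' == j) && (a' < a)%N then o i a j *: x i a else 0.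
  by move=> aa; have [_ ->] := fE j i a a'; rewrite (negbTE aa).
have x_tri (i j : I) (ij : (i < j)%N) : x i j = 0 := tbar_gt0 s q ij.
have x_diag i j a : f (x i j) a a = (sgn i a * rdiagV s q j a) *: x i j.
  by have [_ ->] := fE j i a a; rewrite eqxx.
have o_neq0 (i j a : I) : o i a j != 0.
  by rewrite mulf_neq0 ?koszul_neq0 // oppr_eq0 nu_neq0.
have tri_tb i : tri f 0 (tbar i i).
  apply: tri_diag_letter => [a a' lt_a|a]; last first.
    by rewrite (x_diag i i); apply: prop_scale; rewrite mulf_neq0 ?koszul_neq0 ?rdiagV_neq0.
  rewrite (x_off i i); last by rewrite -val_eqE /= gtn_eqF.
  by case: eqP => [ai|//]; rewrite /= lt_a -ai (x_tri _ _ lt_a) scaler0.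
have tri_t i j : tri f 0 (t i j).
  apply: tri_diag_letter => [a a' lt_a|a].
    by have [-> _] := fE i j a a'; rewrite -val_eqE /= (gtn_eqF lt_a) (ltnNge a) (ltnW lt_a) andbF.
  have [-> _] := fE i j a a; rewrite eqxx; apply: prop_scale.
  by rewrite mulf_neq0 ?koszul_neq0 // /rdiag mulf_neq0 ?koszul_neq0 // q_X_neq0.
have triW y : tri f 0 y -> tri f r y by move=> h e _; apply: h.
have triLDC : tri f r (L * diag_part b * C).
  apply: triM; [apply: triM|].
  - by apply: tri_prod => i _; apply: tri_prod => j _; apply/triX/triW.
  - by apply: tri_prod => i _; apply/triW/tri_tde.
  rewrite /C /upper_left big_seq; apply: tri_prod => i /hs1 ir.
  by apply: tri_prod => j _; apply: triX; apply: (tri_x q0 x_tri x_off x_diag).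
have YE : Y = \prod_(j <- u2 | (j \in u2) && (j < r)%N) x r j ^+ `|b j r|%N.
  by rewrite /Y /upper_mid big_seq_cond.
have wY : window f r c Y.
  rewrite YE; apply: window_prod => j /andP[/hu2 /ltnW cj _].
  by apply: windowX; apply: (window_x x_tri x_off).
have sY : stable_col f c Y.
  rewrite YE; apply: stable_col_prod => j /andP[/hu2 cj _].
  apply: stable_colX; apply: (stable_col_x q0 x_off x_diag).
  by rewrite -val_eqE /= gtn_eqF.
have hm : parity r (+) parity c ==> (m <= 1)%N by rewrite addbC; apply: pbw_odd.
have tri_1 : tri f 0 1 by apply: tri1.
have := entry_row q0 q_nroot x_tri o_neq0 x_off x_diag (tbar_mu s q0) cr triLDC wY sY tri_1 hm.
rewrite -XbE; case: ifP => // m0 h2; apply: (prop_trans h2).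
have D' : prop_to (diag_part (upper_shift b)) (tbar r r * diag_part b).
  apply: (@diag_part_shift _ _ r); first exact: qcomm_tbar_tde.
    by rewrite upper_shift_rr tdeS_tbar.
  by move=> i ir; apply: upper_shift_other; rewrite xpair_eqE (negbTE ir) // andbC.
have L' : \prod_(i < n.+1) lower_row (upper_shift b) i = L.
  apply: eq_bigr => i _; apply: eq_bigr => j ji; rewrite upper_shift_neq //.
    by rewrite -val_eqE /= gtn_eqF.
  by rewrite xpair_eqE; apply/negP => /andP[/eqP e1 /eqP e2]; move: ji; rewrite e1 e2 ltnNge ltnW.
have C' : upper_left (upper_shift b) s1 = C.
  apply: eq_big_seq => i /hs1 ir; apply: eq_bigr => j ji; rewrite upper_shift_neq //.
    by rewrite -val_eqE /= ltn_eqF.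
  by rewrite xpair_eqE andbC -val_eqE /= (ltn_eqF ir).
have Y' : upper_mid (upper_shift b) u2 = Y.
  rewrite YE /upper_mid big_seq_cond; apply: eq_bigr => j /andP[/hu2 cj jr].
  rewrite upper_shift_neq // ?xpair_eqE -val_eqE /= ?(gtn_eqF cj) //.
  by rewrite ltn_eqF.
have m' : `|upper_shift b c r|%N = m.-1.
  by rewrite upper_shift_cr; apply: absz_subr1 (pbw_ge0 pb rc) m0.
rewrite pbwE (@upper_factor s1 s2 u1 u2) // ?L' ?Y' ?C' ?m'; last first.
- move=> j jc; rewrite upper_shift_neq ?b2 // ?xpair_eqE -val_eqE /= ?(ltn_eqF jc) // ltn_eqF //.
  by rewrite (ltn_trans jc).
- move=> i j ji ri; rewrite upper_shift_neq ?b1 // ?xpair_eqE -?val_eqE /= ?(gtn_eqF ri) ?andbF //.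
  by rewrite ltn_eqF.
apply: prop_sym; rewrite mulr1 !mulrA; apply: prop_mul _ (prop_refl _).
rewrite -!mulrA; apply: prop_mul (prop_refl _) _.
apply: (@prop_trans _ _ (tbar r r * (diag_part b * (C * x r c ^+ m.-1)))).
  by rewrite (mulrA (tbar r r)); apply: prop_mul D' (prop_refl _).
have -> : diag_part b * (C * (x r c ^+ m.-1 * x r r)) = diag_part b * (C * x r c ^+ m.-1) * x r r.
  by rewrite !mulrA.
apply: qcommM; first by apply: qcomm_prod => i _; apply: qcomm_tbar_tde.
apply: qcommM; last by apply/qcommX/qcomm_tbarii_tbar.
by apply: qcomm_prod => i _; apply: qcomm_prod => j _; apply/qcommX/qcomm_tbarii_tbar.
Qed.

Lemma upper_indep :
  indep_on X (fun b => upper_cond b /\ `|b c r|%N = 0%N) -> indep_on X upper_cond.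
Proof.
have [f fE] := hom_l s q0.
have rc : c != r by rewrite -val_eqE /= ltn_eqF.
apply: (indep_lower (h := fun b : M => `|b c r|%N) (sh := upper_shift) (g := fun x => f x r c)).
- by rewrite linear0 mxE.
- by move=> x y; rewrite raddfD alg_mxDE.
- by move=> k x; rewrite linearZ alg_mxZE.
- exact: upper_shiftK.
- by move=> b Pb hb; have := upper_step fE Pb; rewrite hb.
- by move=> b Pb hb; have := upper_step fE Pb; rewrite hb.
move=> b [[pb b0] b1 b2] /= hb; have m' : `|upper_shift b c r|%N = `|b c r|%N.-1.
  by rewrite upper_shift_cr; exact: absz_subr1 (pbw_ge0 pb rc) hb.
split; last by rewrite m' ltn_predL.
split; first split.
- by apply: (pbw_update pb (@upper_shift_neq b)); rewrite ?upper_shift_cr.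
- move=> i j ji; rewrite upper_shift_neq ?b0 //; first by rewrite -val_eqE /= gtn_eqF.
  by rewrite xpair_eqE; apply/negP => /andP[/eqP e1 /eqP e2]; move: ji; rewrite e1 e2 ltnNge ltnW.
- move=> i j ji ri; rewrite upper_shift_neq ?b1 //; first by rewrite -val_eqE /= ltn_eqF.
  by rewrite xpair_eqE andbC -val_eqE /= (gtn_eqF ri).
- move=> j jc; rewrite upper_shift_neq ?b2 //.
    by rewrite -val_eqE /= ltn_eqF // (ltn_trans jc).
  by rewrite xpair_eqE -val_eqE /= (ltn_eqF jc).
Qed.
End UpperStep.

(** * Diagonal monomials as eigenvectors *)

Section Diagonal.
Definition diag_cond (b : M) : Prop :=
  (pbw_exponents s b /\ (forall i j : I, (j < i)%N -> `|b i j|%N = 0%N)) /\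
  (forall i j : I, (j < i)%N -> `|b j i|%N = 0%N).

Lemma diag_condE b : diag_cond b -> X b = diag_part b.
Proof.
move=> [[_ b1] b2]; rewrite pbwE big1 ?mul1r => [|i _]; last first.
  by apply: big1 => j ji; rewrite b1.
by rewrite big1 ?mulr1 // => i _; apply: big1 => j ji; rewrite b2.
Qed.

Lemma diag_indep : indep_on X diag_cond.
Proof.
have [f fE] := hom_r s q0.
have vu i : sgn i i * rdiagV s q i i = (q_ i)^-1.
  by rewrite /rdiagV mulrA koszul_sq mul1r eqxx.
have uq i : sgn i i * rdiag s q i i = q_ i.
  by rewrite /rdiag mulrA koszul_sq mul1r eqxx.
(* Vectors whose image is y times a diagonal scalar matrix; the scalars multiply along products,
   which gives the eigenvalue q_a^(b_aa) at (a, a). *)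
pose dg y (al : I -> K) := forall a b : I, f y a b = if a == b then al a *: y else 0.
have dg1 : dg 1 (fun=> 1) by move=> a b; rewrite entry1 scale1r; case: (a == b).
have dgM y z al be : dg y al -> dg z be -> dg (y * z) (fun a => al a * be a).
  move=> hy hz a b; rewrite entryM (bigD1 a) //= big1 ?addr0 => [|c ca].
    rewrite hy eqxx hz; case: (a == b); last by rewrite mulr0.
    by rewrite -scalerAl -scalerAr scalerA.
  by rewrite hy eq_sym (negbTE ca) mul0r.
have dgX y al k : dg y al -> dg (y ^+ k) (fun a => al a ^+ k).
  move=> hy; elim: k => [|k IHk]; first exact: dg1.
  move=> a b; rewrite exprS; have := dgM _ _ _ _ hy IHk a b.
  by rewrite exprS.
have dgt i : dg (t i i) (fun a => if i == a then (q_ i)^-1 else 1).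
  move=> a b; have [-> _] := fE i i a b; case: (eqVneq a b) => [_|ab].
    case: (eqVneq i a) => [<-|ia]; first by rewrite vu.
    by rewrite /rdiagV (negbTE ia) mulr1 koszul_sq scale1r.
  case: ifP => // /andP[/eqP -> lt_a]; by rewrite (t_lt0 _ _ lt_a) scaler0.
have dgtb i : dg (tbar i i) (fun a => if i == a then q_ i else 1).
  move=> a b; have [_ ->] := fE i i a b; case: (eqVneq a b) => [_|ab].
    case: (eqVneq i a) => [<-|ia]; first by rewrite uq.
    by rewrite /rdiag (negbTE ia) mulr1 koszul_sq scale1r.
  case: ifP => // /andP[/eqP -> lt_a]; by rewrite (tbar_gt0 _ _ lt_a) scaler0.
have dgtde i z : dg (tde i z) (fun a => if i == a then q_ i ^ z else 1).
  move=> a b; case: z => k /=.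
    by rewrite (dgX _ _ _ (dgtb i)); case: (i == a) => //; rewrite expr1n.
  by rewrite (dgX _ _ _ (dgt i)); case: (i == a); rewrite ?expr1n // exprVn.
have dgD (b : M) : dg (diag_part b) (fun a => q_ a ^ b a a).
  suff H (l : seq I) : uniq l -> dg (\prod_(i <- l) tde i (b i i))
      (fun a => if a \in l then q_ a ^ b a a else 1).
    rewrite /diag_part big_ord_enum => a a'.
    by rewrite (H _ (enum_uniq _)) mem_enum inE.
  elim: l => [|i l IHl] /=; first by rewrite big_nil => _; apply: dg1.
  move=> /andP[il ul] a a'; rewrite big_cons (dgM _ _ _ _ (dgtde i (b i i)) (IHl ul)).
  rewrite inE (eq_sym a i); case: (eqVneq i a) => [<-|_] /=; last by rewrite mul1r.
  by rewrite (negbTE il) mulr1.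
(* Eigenvectors have to be nonzero: diagonal monomials are right invertible, and 1 is nonzero in
   [Uq]. *)
have inv_tde i z : exists y, tde i z * y = 1.
  case: z => k; [exists (t i i ^+ k)|exists (tbar i i ^+ k.+1)];
  rewrite /= -exprMn_comm ?expr1n ?tK ?tbarK ?expr1n //.
  - by rewrite /GRing.comm tK ?tbarK.
  - by rewrite /GRing.comm tK ?tbarK.
have inv_D (b : M) : exists y, diag_part b * y = 1.
  rewrite /diag_part; elim/big_ind: _ => [|y z [y' e] [z' e']|i _]; first by exists 1; rewrite mulr1.
    by exists (z' * y'); rewrite mulrA -(mulrA y) e' mulr1.
  exact: inv_tde.
have qz i (z z' : int) : q_ i ^ z = q_ i ^ z' -> z = z'.
  have qn (k : nat) : (0 < k)%N -> q_ i ^+ k != 1.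
    by move=> k0; rewrite q_E; case: ifP => _; rewrite ?exprVn ?invr_eq1 q_nroot.
  move=> e; have := expfzDr z (- z') (q_neq0 s q0 i); rewrite e -expfzDr ?q_neq0 // subrr expr0z.
  case: (eqVneq (z - z') 0) => [/eqP|]; first by rewrite subr_eq0 => /eqP.
  case: (z - z') => k k0 /=; first by move/eqP; rewrite (negbTE (qn k _)) // lt0n.
  by move/eqP; rewrite invr_eq1 (negbTE (qn k.+1 _)).
apply: (indep_eigen (psi := fun (a : I) x => f x a a) (lam := fun a (b : M) => q_ a ^ b a a)).
- by move=> a; rewrite linear0 mxE.
- by move=> a x y; rewrite raddfD alg_mxDE.
- by move=> a k x; rewrite linearZ alg_mxZE.
- by move=> a b /diag_condE ->; rewrite dgD eqxx.
- move=> b /diag_condE ->; have [y e] := inv_D b; apply/eqP => D0.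
  by move: e; rewrite D0 mul0r => /esym/eqP; rewrite oner_eq0.
move=> b b' [[_ b1] b2] [[_ b1'] b2'] h; apply/matrixP => i j.
have abs0 (z : int) : `|z|%N = 0%N -> z = 0 by move/eqP; rewrite absz_eq0 => /eqP.
have [ij|ji|/val_inj ->] := ltngtP i j; last exact: qz.
  by rewrite (abs0 _ (b2 j i ij)) (abs0 _ (b2' j i ij)).
by rewrite (abs0 _ (b1 i j ji)) (abs0 _ (b1' i j ji)).
Qed.
End Diagonal.

Lemma pbw_indep : indep_on X (pbw_exponents s).
Proof.
apply: (@indep_chain _ _ _ _ _ (fun (b : M) i j => `|b i j|%N)) => [r c cr P|].
  exact: lower_indep.
apply: (@indep_chain _ _ _ _ _ (fun (b : M) i j => `|b j i|%N)) => [r c cr P|].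
  exact: upper_indep.
exact: diag_indep.
Qed.
End Independence.

(** * Spanning *)

Section LinearSpan.
Variable K : fieldType.

Inductive lspan (V : lmodType K) (P : V -> Prop) : V -> Prop :=
| lspan_in x : P x -> lspan P x
| lspan_0 : lspan P 0
| lspan_D x y : lspan P x -> lspan P y -> lspan P (x + y)
| lspan_Z c x : lspan P x -> lspan P (c *: x).

Lemma lspan_sum (V : lmodType K) (P : V -> Prop) (J : Type) (r : seq J) (Q : pred J) (F : J -> V) :
  (forall j, Q j -> lspan P (F j)) -> lspan P (\sum_(j <- r | Q j) F j).
Proof. by move=> h; elim/big_ind: _ => //; [apply: lspan_0|apply: lspan_D]. Qed.

Lemma lspan_map (V W : lmodType K) (g : {linear V -> W}) (P : V -> Prop) (Q : W -> Prop) x :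
  (forall x, P x -> lspan Q (g x)) -> lspan P x -> lspan Q (g x).
Proof.
move=> h; elim=> {x} [x /h //||x y _ hx _ hy|c x _ hx].
- by rewrite linear0; apply: lspan_0.
- by rewrite linearD; apply: lspan_D.
- by rewrite linearZ; apply: lspan_Z.
Qed.

Lemma lspan_sub (V : lmodType K) (P Q : V -> Prop) x :
  (forall x, P x -> lspan Q x) -> lspan P x -> lspan Q x.
Proof.
move=> h; elim=> {x} [x /h //||x y _ hx _ hy|c x _ hx].
- exact: lspan_0.
- exact: lspan_D.
- exact: lspan_Z.
Qed.

Lemma lspan_mul (A : algType K) (P Q R : A -> Prop) x y :
  (forall x y, P x -> Q y -> lspan R (x * y)) -> lspan P x -> lspan Q y -> lspan R (x * y).
Proof.
move=> h; elim=> {x} [x Px||x x' _ hx _ hx'|c x _ hx] hy.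
- elim: hy => {y} [y Qy||y y' _ hy _ hy'|c y _ hy].
  + exact: h.
  + by rewrite mulr0; apply: lspan_0.
  + by rewrite mulrDr; apply: lspan_D.
  + by rewrite -scalerAr; apply: lspan_Z.
- by rewrite mul0r; apply: lspan_0.
- by rewrite mulrDl; apply: lspan_D; [apply: hx|apply: hx'].
- by rewrite -scalerAl; apply: lspan_Z; apply: hx.
Qed.
End LinearSpan.

(** The lock is opened here because the free algebra is a monoid algebra, in which every element is
    a combination of words. *)
Lemma free_alg_words (K : fieldType) (I : choiceType) (x : free_alg K I) :
  lspan (fun z => exists w : seq I, z = \prod_(g <- w) free_var K g) x.
Proof.
move: x; rewrite /free_alg /free_var free_algebra.unlock /= => x.
have word (m : {fmonom I}) :
    << m >> = \prod_(g <- (m : seq I)) (<< fmu g >> : ncpoly K I) :> ncpoly K I.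
  rewrite -[LHS]/(<< 1 *g m >>); case: m => w /=.
  elim: w => [|g w IHw].
    rewrite big_nil; congr (<< _ *g _ >>); apply/val_inj; rewrite /= fm1 //.
  rewrite big_cons -IHw [RHS]malgM_def fgmulUU mulr1; congr (<< _ *g _ >>).
  by apply/val_inj; rewrite /= fmM fmU.
rewrite [x]monalgE; apply: lspan_sum => m _.
have -> : << x@_m *g m >> = x@_m *: (<< m >> : ncpoly K I).
  by apply/malgP => k; rewrite mcoeffZ !mcoeffU mulr_natr.
by apply: lspan_Z; rewrite word; apply: lspan_in; exists m.
Qed.

Section PropSpan.
Variables (K : fieldType) (A : algType K).
Lemma prop_lspan (P : A -> Prop) x y : prop_to x y -> lspan P y -> lspan P x.
Proof. by move=> [k _ ->]; apply: lspan_Z. Qed.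

Lemma prop_lspan_in (P : A -> Prop) x y : prop_to x y -> P y -> lspan P x.
Proof. by move=> h Py; apply: prop_lspan h _; apply: lspan_in. Qed.

Lemma lspan_mulr (P Q : A -> Prop) x y :
  (forall z, P z -> lspan Q (z * y)) -> lspan P x -> lspan Q (x * y).
Proof.
move=> h hx; apply: (lspan_mul (P := P) (Q := fun z => z = y)) hx _; last exact: lspan_in.
by move=> z _ Pz ->; apply: h.
Qed.

Lemma lspan_mull (P Q : A -> Prop) x y :
  (forall z, P z -> lspan Q (y * z)) -> lspan P x -> lspan Q (y * x).
Proof.
move=> h hx; apply: (lspan_mul (P := fun z => z = y) (Q := P)) _ hx; last exact: lspan_in.
by move=> _ z -> Pz; apply: h.
Qed.
End PropSpan.

(** * Sorting words by rows *)

Section RowSorting.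
Variables (K : fieldType) (A : algType K) (n : nat).
Local Notation I := 'I_n.
(* To be used with x i j = t_ij and with x i j = \bar t_ji. *)
Variables (x : I -> I -> A) (odd : I -> I -> bool).
Hypotheses (x_tri : forall i j : I, (i < j)%N -> x i j = 0)
  (x_str : forall i j k l : I, (k < i)%N ->
     exists a b : K, x i j * x k l = a *: (x k l * x i j) + b *: (x k j * x i l))
  (x_row : forall i j l, qcomm (x i j) (x i l))
  (x_odd : forall i j, odd i j -> x i j * x i j = 0)
  (x_diag : forall i k l, qcomm (x i i) (x k l)).

Definition row_word (i : I) (y : A) : Prop :=
  exists2 w : seq I, all (fun j : I => j < i)%N w & y = \prod_(j <- w) x i j.
Definition diag_word (y : A) : Prop :=
  exists w : seq I, y = \prod_(j <- w) x j j.

Lemma row_word1 i : row_word i 1.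
Proof. by exists [::]; rewrite ?big_nil. Qed.

Lemma row_wordM i y z : row_word i y -> row_word i z -> row_word i (y * z).
Proof.
by move=> [w hw ->] [w' hw' ->]; exists (w ++ w'); rewrite ?all_cat ?hw ?big_cat.
Qed.

Lemma row_wordx (i j : I) : (j < i)%N -> row_word i (x i j).
Proof. by move=> ji; exists [:: j]; rewrite /= ?ji ?big_seq1. Qed.

Lemma diag_word1 : diag_word 1.
Proof. by exists [::]; rewrite big_nil. Qed.

Lemma diag_wordM y z : diag_word y -> diag_word z -> diag_word (y * z).
Proof. by move=> [w ->] [w' ->]; exists (w ++ w'); rewrite big_cat. Qed.

Lemma diag_wordx i : diag_word (x i i).
Proof. by exists [:: i]; rewrite big_seq1. Qed.

Lemma qcomm_diag_word d k l : diag_word d -> qcomm (x k l) d.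
Proof. by move=> [w ->]; apply: qcomm_prod => j _; apply/qcomm_sym. Qed.

Lemma qcomm_row_diag i y d : row_word i y -> diag_word d -> qcomm d y.
Proof.
by move=> [w _ ->] hd; apply: qcomm_prod => j _; apply/qcomm_sym/qcomm_diag_word.
Qed.

(** The case l = k is included because an exchange may turn the moving letter into the diagonal
    x_kk. *)
Definition pushed_left (i k : I) (z : A) : Prop :=
  exists (l : I) y, [/\ (l <= k)%N, row_word i y & z = x k l * y].

(** An exchange swaps the second indices at most, so there is still one letter of row k, and the
    induction on the word of row i goes through. The swapped term x_kj x_il is zero for j > k, and
    x_il is off the diagonal since l <= k < i. *)
Lemma row_exchange (i k l : I) y : (k < i)%N -> (l <= k)%N -> row_word i y ->
  lspan (pushed_left i k) (y * x k l).
Proof.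
move=> ki lk [w hw ->]; elim/last_ind: w l lk hw => [|w j IHw] l lk.
  by rewrite big_nil mul1r => _; apply: lspan_in; exists l, 1; rewrite mulr1; split=> //; apply: row_word1.
rewrite all_rcons => /andP[ji hw]; rewrite -cats1 big_cat big_seq1 /= -mulrA.
have [a [b ->]] := x_str j l ki; rewrite mulrDr -!scalerAr !mulrA.
have H (l1 j1 : I) : (l1 <= k)%N -> (j1 < i)%N ->
    lspan (pushed_left i k) (\prod_(j <- w) x i j * x k l1 * x i j1).
  move=> l1k j1i; apply: lspan_mulr (IHw _ l1k hw) => _ [l' [y' [l'k hy' ->]]].
  apply: lspan_in; exists l', (y' * x i j1); rewrite mulrA; split=> //.
  exact/row_wordM/row_wordx.
apply: lspan_D; apply: lspan_Z; first exact: H.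
case: (leqP j k) => [jk|kj]; first by apply: H; rewrite // (leq_ltn_trans lk).
by rewrite (x_tri kj) mulr0 mul0r; apply: lspan_0.
Qed.

Definition rows_diag (l : seq I) (z : A) : Prop :=
  exists (w : I -> A) (d : A), [/\ forall i, row_word i (w i), diag_word d &
    z = \prod_(i <- l) w i * d].

(** The new letter travels left through the later rows until it meets its own. Should it become
    diagonal on the way, it is sent to the right end instead, up to a scalar. *)
Lemma rows_insert (s : seq I) (w : I -> A) (k l : I) :
  pairwise (fun i j : I => i < j)%N s -> k \in s -> (l < k)%N -> (forall i, row_word i (w i)) ->
  lspan (rows_diag s) (\prod_(i <- s) w i * x k l).
Proof.
elim/last_ind: s w k l => // s i IHs w k l.
rewrite pairwise_rcons => /andP[hs ss]; rewrite mem_rcons inE => kin lk hw.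
have i_s (w1 w2 : I -> A) : \prod_(j <- s) (if j == i then w2 j else w1 j) = \prod_(j <- s) w1 j.
  apply: eq_big_seq => j js; have /= := allP hs j js.
  by case: eqP => // ->; rewrite ltnn.
rewrite -cats1 big_cat big_seq1 /= -mulrA.
have [ki|ki] := eqVneq k i.
  apply: lspan_in; exists (fun j => if j == i then w i * x k l else w j), 1.
  split; [|exact: diag_word1|].
    move=> j; case: eqP => [->|_]; last exact: hw.
    by rewrite ki; apply/row_wordM/row_wordx; rewrite -?ki.
  by rewrite mulr1 big_cat big_seq1 /= eqxx i_s.
rewrite (negbTE ki) /= in kin; have /= lt_ki := allP hs k kin.
apply: lspan_mull (row_exchange lt_ki (ltnW lk) (hw i)) => _ [l' [y [l'k hy ->]]].
have glue w' d : (forall j, row_word j (w' j)) -> diag_word d ->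
    lspan (rows_diag (s ++ [:: i])) (\prod_(j <- s) w' j * d * y).
  move=> hw' hd; apply: (@prop_lspan_in _ _ _ _ (\prod_(j <- s) w' j * y * d)).
    rewrite -!mulrA; apply: prop_mul (prop_refl _) _; exact: qcomm_row_diag hy hd.
  exists (fun j => if j == i then y else w' j), d; split=> //.
    by move=> j; case: eqP => [->|].
  by rewrite big_cat big_seq1 /= eqxx i_s.
rewrite mulrA; move: l'k; rewrite leq_eqVlt => /predU1P[/val_inj ->|l'k].
  exact/glue/diag_wordx.
apply: lspan_mulr (IHs w k l' ss kin l'k hw) => _ [w' [d [hw' hd ->]]].
exact: glue.
Qed.

Lemma ord_enum_pairwise : pairwise (fun i j : I => i < j)%N (enum 'I_n).
Proof.
have := iota_ltn_sorted 0 n; rewrite -val_enum_ord sorted_map sorted_pairwise //.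
by move=> ? ? ?; apply: ltn_trans.
Qed.

Lemma words_rows_diag (w : seq (I * I)) :
  lspan (rows_diag (enum 'I_n)) (\prod_(p <- w) x p.1 p.2).
Proof.
elim/last_ind: w => [|w [k l] IHw].
  rewrite big_nil; apply: lspan_in; exists (fun=> 1), 1.
  by split; [move=> i; apply: row_word1|apply: diag_word1|rewrite big1 ?mulr1].
rewrite -cats1 big_cat big_seq1 /=; apply: lspan_mulr IHw => _ [v [d [hv hd ->]]].
case: (ltngtP k l) => [kl|lk|/val_inj <-].
- by rewrite (x_tri kl) mulr0; apply: lspan_0.
- apply: (@prop_lspan _ _ _ _ (\prod_(i <- enum 'I_n) v i * x k l * d)).
    by rewrite -!mulrA; apply: prop_mul (prop_refl _) _; apply/qcomm_sym/qcomm_diag_word.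
  have := rows_insert ord_enum_pairwise (mem_enum _ k) lk hv.
  apply: lspan_mulr => _ [v' [d' [hv' hd' ->]]]; apply: lspan_in.
  by exists v', (d' * d); rewrite mulrA; split=> //; apply: diag_wordM.
- by apply: lspan_in; exists v, (d * x k k); rewrite mulrA; split=> //; apply/diag_wordM/diag_wordx.
Qed.

(** The order of the second indices inside a row: decreasing for the t's, increasing for the \bar
    t's. *)
Variable o : seq I.
Hypotheses (o_uniq : uniq o) (o_all : forall i, i \in o).

Definition row_mono (e : I -> nat) (i : I) : A := \prod_(j <- o | (j < i)%N) x i j ^+ e j.

Lemma row_mono_mul (e : I -> nat) (i j : I) : (j < i)%N ->
  prop_to (x i j * row_mono e i) (row_mono (fun k => if k == j then (e k).+1 else e k) i).
Proof.
move=> ji; have := o_uniq; rewrite /row_mono.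
case/splitPr: {1 2 3}o / (o_all j) => u1 u2; rewrite cat_uniq /= negb_or.
move=> /and4P[_ /andP[ju1 _] ju2 _].
rewrite !big_cat !big_cons ji eqxx /= exprS.
have E u : j \notin u -> \prod_(k <- u | (k < i)%N) x i k ^+ (if k == j then (e k).+1 else e k) =
   \prod_(k <- u | (k < i)%N) x i k ^+ e k.
  move=> ju; rewrite big_seq_cond [RHS]big_seq_cond; apply: eq_bigr => k /andP[ku _].
  by case: eqP => // kj; rewrite -kj ku in ju.
rewrite !E // !mulrA; do 2!apply: prop_mul _ (prop_refl _).
by apply: qcomm_prod => k _; apply: qcommX.
Qed.

Lemma row_word_mono i y : row_word i y ->
  y = 0 \/ exists2 e : I -> nat, (forall j : I, (j < i)%N -> odd i j -> (e j <= 1)%N)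
    & prop_to y (row_mono e i).
Proof.
move=> [w hw ->]; elim: w hw => [|j w IHw] /=.
  move=> _; right; exists (fun=> 0%N) => //; rewrite big_nil /row_mono big1 //.
  exact: prop_refl.
rewrite big_cons => /andP[ji /IHw[->|[e he pe]]]; first by left; rewrite mulr0.
(* A second copy of an odd letter makes the word zero; this is the source of the alternative y =
   0. *)
have [oe|oe] := boolP (odd i j && (e j == 1%N)).
  left; case/andP: oe => oij /eqP ej.
  case: (prop_trans (prop_mul (prop_refl (x i j)) pe) (row_mono_mul e ji)) => k _ ->.
  rewrite /row_mono; case/splitPr: {1}o / (o_all j) => u1 u2.
  by rewrite big_cat big_cons ji /= eqxx ej expr2 x_odd // mul0r mulr0 scaler0.
right; exists (fun k => if k == j then (e k).+1 else e k).
  move=> k ki ok; case: eqP => [kj|_]; last exact: he.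
  move: oe (he k ki ok); rewrite -kj ok /=; case: (e k) => [|[|]] //.
exact: prop_trans (prop_mul (prop_refl _) pe) (row_mono_mul _ ji).
Qed.

Lemma words_row_mono (w : seq (I * I)) :
  lspan (fun z => exists (e : I -> I -> nat) (d : A),
    [/\ forall i j : I, (j < i)%N -> odd i j -> (e i j <= 1)%N, diag_word d &
        z = \prod_(i < n) row_mono (e i) i * d]) (\prod_(p <- w) x p.1 p.2).
Proof.
apply: lspan_sub (words_rows_diag w) => _ [v [d [hv hd ->]]].
case: (pselect (exists i, v i = 0)) => [[i vi]|nv].
  have [s1 [s2 [-> _ _]]] := enum_ord_split i.
  by rewrite big_cat big_cons /= vi mul0r mulr0 mul0r; apply: lspan_0.
have /choice[e he] : forall i : I, exists e : I -> nat,
    (forall j : I, (j < i)%N -> odd i j -> (e j <= 1)%N) /\ prop_to (v i) (row_mono e i).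
  move=> i; have [vi|[e h1 h2]] := row_word_mono (hv i); last by exists e.
  by case: nv; exists i.
apply: (@prop_lspan_in _ _ _ _ (\prod_(i < n) row_mono (e i) i * d)).
  apply: prop_mul _ (prop_refl _); rewrite big_ord_enum.
  by apply: prop_prod => i _; case: (he i).
by exists e, d; split=> // i j; case: (he i) => h _; apply: h.
Qed.
End RowSorting.

(** * Spanning by ordered monomials, and the basis *)

Section Spanning.
Variables (K : fieldType) (n : nat) (s : n.+1.-tuple bool) (q : K).
Hypotheses (q0 : q != 0) (q_nroot : forall k : nat, (0 < k)%N -> q ^+ k != 1).
Local Notation I := 'I_n.+1.
Local Notation U := (Uq s q).
Local Notation t := (t s q).
Local Notation tbar := (tbar s q).
Local Notation parity := (parity s).
Local Notation M := 'M[int]_n.+1.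
Local Notation X := (pbw_monomial s q).

Definition t_word (z : U) : Prop := exists w : seq (I * I), z = \prod_(p <- w) t p.1 p.2.
(** Pairs are stored column first, to fit x_ij = \bar t_ji in the sorting of rows. *)
Definition tbar_word (z : U) : Prop := exists w : seq (I * I), z = \prod_(p <- w) tbar p.2 p.1.
Definition t_tbar_word (z : U) : Prop := exists y y', [/\ t_word y, tbar_word y' & z = y * y'].

Lemma t_wordM y z : t_word y -> t_word z -> t_word (y * z).
Proof. by move=> [w ->] [w' ->]; exists (w ++ w'); rewrite big_cat. Qed.

Lemma tbar_wordM y z : tbar_word y -> tbar_word z -> tbar_word (y * z).
Proof. by move=> [w ->] [w' ->]; exists (w ++ w'); rewrite big_cat. Qed.

Lemma t_wordx i j : t_word (t i j).
Proof. by exists [:: (i, j)]; rewrite big_seq1. Qed.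

Lemma tbar_wordx i j : tbar_word (tbar i j).
Proof. by exists [:: (j, i)]; rewrite big_seq1. Qed.

Definition t_tbar_letters (z : U) : Prop := exists i j k l, z = t i j * tbar k l.

(* The term in \bar t_kj t_il comes with j < l, so it shortens both intervals. *)
Lemma tbar_t_letters (i j k l : I) : lspan t_tbar_letters (tbar k l * t i j).
Proof.
have [m] := ubnP (l - k + (i - j))%N.
elim: m i j k l => // m IHm i j k l lt_m.
case: (ltnP i j) => [ij|ji]; first by rewrite (t_lt0 _ _ ij) mulr0; apply: lspan_0.
case: (ltnP l k) => [lk|kl]; first by rewrite (tbar_gt0 _ _ lk) mul0r; apply: lspan_0.
have [a [b [c ->]]] := tbar_t_straighten s q0 i j k l.
apply: lspan_D; last first.
  by apply/lspan_Z/lspan_in; exists k, j, i, l.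
apply: lspan_D; first by apply/lspan_Z/lspan_in; exists i, j, k, l.
case: (ltnP j l) => [jl|_]; last by rewrite mulr0 scale0r; apply: lspan_0.
apply: lspan_Z.
case: (ltnP i l) => [il|li]; first by rewrite (t_lt0 _ _ il) mulr0; apply: lspan_0.
case: (ltnP j k) => [jk|kj]; first by rewrite (tbar_gt0 _ _ jk) mul0r; apply: lspan_0.
by apply: IHm; lia.
Qed.

(** Each exchange again yields one t followed by one \bar t, so the t leaves a shorter word to
    cross. *)
Lemma tbar_word_t y (i j : I) : tbar_word y ->
  lspan (fun z => exists (k l : I) y', tbar_word y' /\ z = t k l * y') (y * t i j).
Proof.
move=> [w ->]; elim/last_ind: w i j => [|w [l k] IHw] i j.
  rewrite big_nil mul1r; apply: lspan_in; exists i, j, 1; rewrite mulr1; split=> //.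
  by exists [::]; rewrite big_nil.
rewrite -cats1 big_cat big_seq1 /= -mulrA.
apply: lspan_mull (tbar_t_letters i j k l) => _ [i1 [j1 [k1 [l1 ->]]]]; rewrite mulrA.
apply: lspan_mulr (IHw i1 j1) => _ [i2 [j2 [y' [hy' ->]]]]; apply: lspan_in.
by exists i2, j2, (y' * tbar k1 l1); rewrite mulrA; split=> //; apply/tbar_wordM/tbar_wordx.
Qed.

Lemma Uq_words (x : U) : lspan t_tbar_word x.
Proof.
have -> : x = Uq_pi s q (repr x) by rewrite /Uq_pi reprK.
move: (repr x) => y; apply: (lspan_map (g := Uq_pi s q)) (free_alg_words y) => _ [w ->].
elim/last_ind: w => [|w g IHw].
  rewrite big_nil rmorph1; apply: lspan_in; exists 1, 1; rewrite mulr1.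
  by split=> //; exists [::]; rewrite big_nil.
rewrite -cats1 big_cat big_seq1 rmorphM /=.
have [[i [j ->]]|[i [j ->]]] : (exists i j, Uq_pi s q (free_var K g) = t i j) \/
    (exists i j, Uq_pi s q (free_var K g) = tbar i j).
- case: g {IHw} => u; [left|right]; exists (val u).1, (val u).2;
  by rewrite /t /tbar /free_t /free_tbar -surjective_pairing valK.
- apply: lspan_mulr IHw => _ [y1 [y2 [h1 h2 ->]]]; rewrite -mulrA.
  apply: lspan_mull (tbar_word_t i j h2) => _ [k [l [y' [hy' ->]]]]; apply: lspan_in.
  by exists (y1 * t k l), y'; rewrite mulrA; split=> //; apply/t_wordM/t_wordx.
- apply: lspan_mulr IHw => _ [y1 [y2 [h1 h2 ->]]]; apply: lspan_in.
  by exists y1, (y2 * tbar i j); rewrite mulrA; split=> //; apply/tbar_wordM/tbar_wordx.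
Qed.

Lemma diag_words (w w' : seq I) : exists b : M,
  prop_to (\prod_(j <- w) t j j * \prod_(j <- w') tbar j j) (diag_part s q b).
Proof.
elim: w => [|i w [b hb]].
  rewrite big_nil mul1r; elim: w' => [|i w [b hb]].
    exists 0; rewrite big_nil /diag_part big1 => [|i _]; first exact: prop_refl.
    by rewrite mxE.
  exists (b + delta_mx i i); rewrite big_cons.
  apply: prop_trans (prop_mul (prop_refl _) hb) _.
  apply: prop_sym; apply: (diag_part_shift (r := i)); first exact: qcomm_tbar_tde.
    by rewrite !mxE !eqxx tdeS_tbar.
  by move=> j ji; rewrite !mxE (negbTE ji) addr0.
exists (b - delta_mx i i); rewrite big_cons -mulrA.
apply: prop_trans (prop_mul (prop_refl _) hb) _.
apply: prop_sym; apply: (diag_part_shift (r := i)); first exact: qcomm_t_tde.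
  by rewrite !mxE !eqxx tdeS_t.
by move=> j ji; rewrite !mxE (negbTE ji) subr0.
Qed.

Lemma pbw_span (x : U) : lspan (fun z => exists2 b : M, pbw_exponents s b & z = X b) x.
Proof.
apply: lspan_sub (Uq_words x) => _ [_ [_ [[w ->] [w' ->] ->]]].
pose odd (i j : I) := parity i (+) parity j.
have re_all (i : I) : i \in rev (enum 'I_n.+1) by rewrite mem_rev mem_enum.
have e_all (i : I) : i \in enum 'I_n.+1 by rewrite mem_enum.
have re_uniq : uniq (rev (enum 'I_n.+1)) by rewrite rev_uniq enum_uniq.
have hT := words_row_mono (@t_lt0 _ _ s q) (@t_straighten _ _ s q)
  (@qcomm_t_row _ _ s q q0) (@t_odd_sq _ _ s q q0 q_nroot) (@qcomm_tii_t _ _ s q q0) re_uniq re_all w.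
have b_odd (i j : I) : parity i (+) parity j -> tbar j i * tbar j i = 0.
  by rewrite addbC; apply: tbar_odd_sq.
have hB := @words_row_mono _ _ _ (fun i j => tbar j i) _ (fun i j => @tbar_gt0 _ _ s q j i)
  (fun i j k l => @tbar_straighten _ _ s q i j k l)
  (fun i j l => @qcomm_tbar_col _ _ s q q0 i j l) b_odd
  (fun i k l => @qcomm_tbarii_tbar _ _ s q q0 i l k) _ (enum_uniq _) e_all w'.
apply: lspan_mul hT hB => _ _ [e [d [he [v ->] ->]]] [e' [d' [he' [v' ->] ->]]].
have [b0 hb0] := diag_words v v'.
(* The exponents of the t's fill the lower triangle, those of the \bar t's, transposed, the upper
   one. *)
pose b : M := \matrix_(i, j) if (j < i)%N then (e i j)%:Z else if (i < j)%N then (e' j i)%:Z else b0 i i.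
have bL : \prod_(i < n.+1) lower_row s q b i = \prod_(i < n.+1) row_mono t (rev (enum 'I_n.+1)) (e i) i.
  by apply: eq_bigr => i _; apply: eq_bigr => j ji; rewrite mxE ji.
have bU : \prod_(i < n.+1) upper_col s q b i =
    \prod_(i < n.+1) row_mono (fun i j => tbar j i) (enum 'I_n.+1) (e' i) i.
  apply: eq_bigr => i _; rewrite /upper_col big_ord_enum; apply: eq_bigr => j ji.
  by rewrite mxE ji ltnNge ltnW.
have bD : diag_part s q b = diag_part s q b0.
  by apply: eq_bigr => i _; rewrite mxE ltnn.
apply: (@prop_lspan_in _ _ _ _ (X b)); last first.
  exists b => //; apply/forallP => i; apply/forallP => j; apply/implyP => ij; rewrite mxE.
  case: (ltngtP i j) ij => [ij _|ji _|/val_inj ->]; last by rewrite eqxx.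
    apply/implyP => p; apply: he' => //; by rewrite addbC.
  by apply/implyP => p; apply: he.
rewrite pbwE bL bU bD -!mulrA; apply: prop_mul (prop_refl _) _.
rewrite (mulrA (\prod_(j <- v) t j j)); set D := \prod_(j <- v') _.
apply: (@prop_trans _ _ (\prod_(j <- v) t j j * D *
    \prod_(i < n.+1) row_mono (fun i j => tbar j i) (enum 'I_n.+1) (e' i) i)); last first.
  exact: prop_mul hb0 (prop_refl _).
(* Sorting leaves the diagonal \bar t's after the other \bar t's; they commute with these up to
   scalars and move left to join the diagonal t's. *)
rewrite -!mulrA; apply: prop_mul (prop_refl _) _; apply: qcomm_sym.
apply: qcomm_prod => i _; apply: qcomm_prod => j _; apply: qcommX.
by apply: qcomm_sym; apply: qcomm_prod => k _; apply/qcomm_sym/qcomm_tbarii_tbar.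
Qed.

Theorem pbw_basis : is_basis (K := K) (V := U)
    (fun b : {b : M | pbw_exponents s b} => X (val b)).
Proof.
split=> [r c ur rel b br|x].
  (* Coefficients are extended by zero to all integer matrices, where [pbw_indep] lives. *)
  pose c' (b : M) := if insub b is Some b' then c b' else 0.
  have c'E (b' : {b : M | pbw_exponents s b}) : c' (val b') = c b' by rewrite /c' valK.
  rewrite -c'E; apply: (pbw_indep q0 q_nroot (r := map val r)).
  - by rewrite map_inj_uniq //; apply: val_inj.
  - by move=> _ /mapP[b' _ ->]; apply: valP.
  - by rewrite big_map -[RHS]rel; apply: eq_bigr => b' _; rewrite c'E.
  - exact: map_f.
pose T := {b : M | pbw_exponents s b}.
have [l ->] : exists l : seq (T * K), x = \sum_(p <- l) p.2 *: X (val p.1).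
  elim: (pbw_span x) => {x} [_ [b hb ->]||_ _ _ [l ->] _ [l' ->]|c _ _ [l ->]].
  - by exists [:: (Sub b hb : T, 1)]; rewrite big_seq1 /= scale1r.
  - by exists [::]; rewrite big_nil.
  - by exists (l ++ l'); rewrite big_cat.
  - exists [seq (p.1, c * p.2) | p <- l]; rewrite big_map scaler_sumr.
    by apply: eq_bigr => p _; rewrite scalerA.
(* A basis coefficient depends on the index alone, so the coefficients of repeated monomials are
   added up. *)
exists (undup (map fst l)), (fun b => \sum_(p <- l | p.1 == b) p.2).
transitivity (\sum_(p <- l) \sum_(b <- undup (map fst l) | p.1 == b) p.2 *: X (val b)).
  rewrite big_seq [RHS]big_seq; apply: eq_bigr => p pl.
  rewrite big_mkcond (bigD1_seq p.1) ?undup_uniq ?mem_undup ?map_f //= eqxx.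
  by rewrite big1 ?addr0 // => b; rewrite eq_sym => /negbTE ->.
rewrite (exchange_big_dep predT) //=; apply: eq_bigr => b _.
by rewrite scaler_suml.
Qed.
End Spanning.

Theorem theorem3p9 (R : realType) (m n : nat) (q : R[i])
    (s : (m + n).-tuple bool) :
  (2 <= m + n)%N ->
  q != 0 ->
  (forall k : nat, (0 < k)%N -> q ^+ k != 1) ->
  is_parity_seq s ->
  is_basis (K := R[i]) (V := Uq s q)
    (fun b : {b : 'M[int]_(m + n) | pbw_exponents s b} =>
       pbw_monomial s q (val b)).
Proof.
(* The bound on m + n excludes size zero, so the matrices have successor size and form a nonzero
   ring. *)
move=> mn q0 q_nroot _; move: mn s; case: (m + n)%N => // N _ s.
exact: pbw_basis.
Qed.
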